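(* Let $\mathfrak{X}$ be an abstract state space, $(\mathcal{U}(t))_{t\ge0}$ a substochastic $C_0$-semigroup on $\mathfrak{X}$ with generator $\mathcal{A}$, $\mathcal{B}:\mathscr{D}(\mathcal{A})\to\mathfrak{X}$ a positive linear operator with $\langle\mathbf{\Psi},(\mathcal{A}+\mathcal{B})u\rangle\le0$ for all $u\in\mathscr{D}(\mathcal{A})\cap\mathfrak{X}_+$, and let $(\mathcal{V}(t))_{t\ge0}$ be the associated minimal semigroup, with generator $\mathcal{G}$. Let $u\in\mathfrak{X}_+$. The trajectory $(\mathcal{V}(t)u)_{t\ge0}$ is honest if and only if $\langle\mathbf{\Xi}_\lambda,u\rangle=0$ for all (equivalently, for some) $\lambda>0$.
   Context: An abstract state space is a real ordered Banach space $\mathfrak{X}$ whose positive cone $\mathfrak{X}_+$ is closed, generating ($\mathfrak{X}=\mathfrak{X}_+-\mathfrak{X}_+$), and on which the norm is additive: $\|u+v\|=\|u\|+\|v\|$ for $u,v\in\mathfrak{X}_+$. $\mathbf{\Psi}\in\mathfrak{X}^\star_+$ is the positive functional with $\langle\mathbf{\Psi},u\rangle=\|u\|$ for $u\in\mathfrak{X}_+$. A linear operator is positive if it maps positive elements of its domain into $\mathfrak{X}_+$. A $C_0$-semigroup $(T(t))_{t\ge0}$ is substochastic if each $T(t)$ is positive and $\|T(t)u\|\le\|u\|$ for $u\in\mathfrak{X}_+$. Minimal semigroup: under the stated hypotheses there is a smallest (for the operator order, for each $t$) substochastic $C_0$-semigroup $(\mathcal{V}(t))_{t\ge0}$ whose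 generator $\mathcal{G}$ extends $(\mathcal{A}+\mathcal{B},\mathscr{D}(\mathcal{A}))$; it satisfies $(\lambda-\mathcal{G})^{-1}u=\lim_{n\to\infty}(\lambda-\mathcal{A})^{-1}\sum_{k=0}^n[\mathcal{B}(\lambda-\mathcal{A})^{-1}]^ku$ for all $\lambda>0$, $u\in\mathfrak{X}$. Functionals: $\mathfrak{a}_0(u)=-\langle\mathbf{\Psi},\mathcal{G}u\rangle$ for $u\in\mathscr{D}(\mathcal{G})$; $\mathfrak{a}$ is its restriction to $\mathscr{D}(\mathcal{A})$, i.e. $\mathfrak{a}(u)=-\langle\mathbf{\Psi},\mathcal{A}u+\mathcal{B}u\rangle$; and $\overline{\mathfrak{a}}:\mathscr{D}(\mathcal{G})\to\mathbb{R}$ is the linear functional defined by $\overline{\mathfrak{a}}((\lambda-\mathcal{G})^{-1}u)=\sum_{n=0}^\infty\mathfrak{a}\big((\lambda-\mathcal{A})^{-1}[\mathcal{B}(\lambda-\mathcal{A})^{-1}]^nu\big)$, $u\in\mathfrak{X}$, where the series converges and the resulting functional does not depend on $\lambda>0$. For $\lambda>0$, $\mathbf{\Xi}_\lambda\in\mathfrak{X}^\star$ is defined by $\langle\mathbf{\Xi}_\lambda,u\rangle=\mathfrak{a}_0((\lambda-\mathcal{G})^{-1}u)-\overline{\mathfrak{a}}((\lambda-\mathcal{G})^{-1}u)$, $u\in\mathfrak{X}$. Honesty: for $u\in\mathfrak{X}_+$, the trajectory $(\mathcal{V}(t)u)_{t\ge0}$ is honest if $\|\mathcal{V}(t)u\|=\|u\|-\overline{\mathfrak{a}}\big(\int_0^t\mathcal{V}(s)u\,\mathrm{d}s\big)$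 for all $t\ge0$. *)

(* Defs.v *)
From Stdlib Require Import Reals.
From Coquelicot Require Import Coquelicot.

Set Implicit Arguments.
Unset Strict Implicit.
Unset Printing Implicit Defensive.

Open Scope R_scope.

(** A real Banach space is a [CompleteNormedModule R_AbsRing]; an order on it is
    given by its positive cone [P : X -> Prop]. *)

Record is_abstract_state_space (X : CompleteNormedModule R_AbsRing)
    (P : X -> Prop) : Prop := {
  cone_plus : forall u v, P u -> P v -> P (plus u v);
  cone_scal : forall (r : R) u, 0 <= r -> P u -> P (scal r u);
  cone_pointed : forall u, P u -> P (opp u) -> u = zero;
  cone_closed : closed P;
  cone_generating : forall x, exists u v, P u /\ P v /\ x = minus u v;
  cone_norm_additive : forall u v, P u -> P v -> norm (plus u v) = norm u + norm v
}.

(** The functional [Psi] is uniquely determined, since the cone generates.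
    Coquelicot's [is_linear] includes boundedness. *)
Definition is_norm_functional (X : CompleteNormedModule R_AbsRing)
    (P : X -> Prop) (Psi : X -> R) : Prop :=
  @is_linear R_AbsRing X R_NormedModule Psi /\ forall u, P u -> Psi u = norm u.

(** Unbounded operators: [op] is a total function, but only its values on [dom]
    are meaningful. *)
Record operator (X : CompleteNormedModule R_AbsRing) := Operator {
  dom : X -> Prop;
  op :> X -> X
}.

Record is_linear_operator (X : CompleteNormedModule R_AbsRing)
    (L : operator X) : Prop := {
  dom_zero : dom L zero;
  dom_plus : forall u v, dom L u -> dom L v -> dom L (plus u v);
  dom_scal : forall (r : R) u, dom L u -> dom L (scal r u);
  op_plus : forall u v, dom L u -> dom L v -> L (plus u v) = plus (L u) (L v);
  op_scal : forall (r : R) u, dom L u -> L (scal r u) = scal r (L u)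
}.

Definition positive_operator (X : CompleteNormedModule R_AbsRing)
    (P : X -> Prop) (L : operator X) : Prop :=
  forall u, dom L u -> P u -> P (L u).

Definition op_add (X : CompleteNormedModule R_AbsRing) (A B : operator X)
    : operator X :=
  {| dom := fun u => dom A u /\ dom B u; op := fun u => plus (A u) (B u) |}.

Definition extends (X : CompleteNormedModule R_AbsRing) (G L : operator X) : Prop :=
  forall u, dom L u -> dom G u /\ G u = L u.

(** [(lambda - L)^{-1} u]. *)
Definition resolvent (X : CompleteNormedModule R_AbsRing) (L : operator X)
    (lambda : R) (u : X) : X :=
  iota (fun w => dom L w /\ minus (scal lambda w) (L w) = u).

(** Only the values [T t] with [0 <= t] matter. *)
Record is_C0_semigroup (X : CompleteNormedModule R_AbsRing)
    (T : R -> X -> X) : Prop := {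
  semigroup_bounded : forall t, 0 <= t -> is_linear (T t);
  semigroup_zero : forall u, T 0 u = u;
  semigroup_plus : forall s t u, 0 <= s -> 0 <= t -> T (s + t) u = T s (T t u);
  semigroup_continuous :
    forall u, filterlim (fun t => T t u) (at_right 0) (locally u)
}.

Definition is_substochastic (X : CompleteNormedModule R_AbsRing)
    (P : X -> Prop) (T : R -> X -> X) : Prop :=
  is_C0_semigroup T /\
  (forall t u, 0 <= t -> P u -> P (T t u)) /\
  (forall t u, 0 <= t -> P u -> norm (T t u) <= norm u).

Definition is_generator_at (X : CompleteNormedModule R_AbsRing)
    (T : R -> X -> X) (u v : X) : Prop :=
  filterlim (fun h => scal (/ h) (minus (T h u) u)) (at_right 0) (locally v).

Definition generator (X : CompleteNormedModule R_AbsRing) (T : R -> X -> X)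
    : operator X :=
  {| dom := fun u => exists v, is_generator_at T u v;
     op := fun u => iota (is_generator_at T u) |}.

(** [V] is the smallest substochastic semigroup, for the operator order at each
    time, whose generator extends [A + B]. *)
Definition is_minimal_semigroup (X : CompleteNormedModule R_AbsRing)
    (P : X -> Prop) (A B : operator X) (V : R -> X -> X) : Prop :=
  is_substochastic P V /\
  extends (generator V) (op_add A B) /\
  forall W : R -> X -> X,
    is_substochastic P W -> extends (generator W) (op_add A B) ->
    forall t u, 0 <= t -> P u -> P (minus (W t u) (V t u)).

(** For [L = G] this is the functional a_0; for [L = A + B] it is a. *)
Definition mass_loss (X : CompleteNormedModule R_AbsRing) (Psi : X -> R)
    (L : operator X) (u : X) : R :=
  - Psi (L u).

(** [(lambda - A)^{-1} [B (lambda - A)^{-1}]^n u]. *)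
Definition series_term (X : CompleteNormedModule R_AbsRing) (A B : operator X)
    (lambda : R) (u : X) (n : nat) : X :=
  resolvent A lambda (Nat.iter n (fun v => B (resolvent A lambda v)) u).

(** The functional a-bar on the domain of [G]: its value at [w] is the common sum,
    over all representations [w = (lambda - G)^{-1} u] with [0 < lambda], of the
    defining series. *)
Definition a_bar (X : CompleteNormedModule R_AbsRing) (Psi : X -> R)
    (A B G : operator X) (w : X) : R :=
  iota (fun l : R_CompleteNormedModule =>
    forall (lambda : R) (u : X), 0 < lambda -> w = resolvent G lambda u ->
      is_series (fun n => mass_loss Psi (op_add A B) (series_term A B lambda u n)) l).

Definition Xi (X : CompleteNormedModule R_AbsRing) (Psi : X -> R)
    (A B G : operator X) (lambda : R) (u : X) : R :=
  mass_loss Psi G (resolvent G lambda u) - a_bar Psi A B G (resolvent G lambda u).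

Definition honest (X : CompleteNormedModule R_AbsRing) (Psi : X -> R)
    (A B : operator X) (V : R -> X -> X) (u : X) : Prop :=
  forall t, 0 <= t ->
    norm (V t u) = norm u - a_bar Psi A B (generator V) (RInt (fun s => V s u) 0 t).

(* Main.v *)
(** With [R = (lambda - A)^-1], [K = B R] and [beta(u) = lim <Psi, K^n u>], the series
    defining [a_bar] telescopes, and [<Xi_lambda, u> = beta(u)].

    The minimal semigroup is known only through its minimality, so the series formula for
    its resolvent has to be recovered. The sums [S_lambda = sum_n R K^n] form a
    pseudo-resolvent with dense range, hence (Hille-Yosida, by implicit Euler schemes) the
    resolvent of some substochastic semigroup [W] with generator extending [A + B].
    Minimality gives [V <= W], so [(lambda - G)^-1 <= S_lambda]; the converse inequality
    holds for every substochastic extension of [A + B].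

    The functional [a_0 - a_bar] does not depend on [lambda] and is nonnegative, hence
    monotone, on the positive part of the domain of [G]. Honesty says that it vanishes at
    [w_t], the integral of the trajectory over [0, t], for all [t]; and up to factors
    [exp (lambda t)] and a vanishing tail, [w_t] and [(lambda - G)^-1 u] dominate each
    other. *)

Require Import Defs.
From Stdlib Require Import Reals Lra Lia List ClassicalEpsilon.
From Coquelicot Require Import Coquelicot.

(** The norm is additive on the cone only, so a substochastic operator need not be a contraction of
    [X], and long products of Euler steps need a bound that does not grow with their number. The
    remedy is the base norm, the infimum of [norm u + norm v] over decompositions [x = u - v] into
    positive elements. Contractions on the cone are contractions for it, and a Baire argument
    ([cone_ball_bound]) bounds it by a multiple of the given norm, so one constant serves all
    iterates.

    Two facts about a_0 - a_bar need a reason. Independence of lambda rests on comparing the losses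
    [Psi u - defect l u] for two parameters, up to the quotient of the parameters: along the
    iterates K^n u the loss tends to zero for one parameter, hence for the other. The sign on
    positive [w] in the domain of G is not immediate, because lambda w - G w need not be positive.
    It is read off at m (m - G)^-1 w, where the functional equals m times the value at [w] of beta
    formed with the parameter m; then m tends to infinity. *)

Section VectorTactic.
Variable X : ModuleSpace R_AbsRing.

(** Reflection for linear identities: vectors become indices into a list of atoms, scalars stay real
    terms, and an identity reduces to one equation between reals per atom, left to [ring] and
    [field]. *)
Inductive vexpr :=
| VVar (n : nat)
| VZero
| VPlus (a b : vexpr)
| VOpp (a : vexpr)
| VScal (r : R) (a : vexpr).

Fixpoint veval (env : list X) (e : vexpr) : X :=
  match e with
  | VVar n => nth n env zero
  | VZero => zero
  | VPlus a b => plus (veval env a) (veval env b)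
  | VOpp a => opp (veval env a)
  | VScal r a => scal r (veval env a)
  end.

Fixpoint vcoef (e : vexpr) (n : nat) : R :=
  match e with
  | VVar m => if Nat.eqb m n then 1 else 0
  | VZero => 0
  | VPlus a b => vcoef a n + vcoef b n
  | VOpp a => - vcoef a n
  | VScal r a => r * vcoef a n
  end.

Fixpoint lincomb (c : nat -> R) (env : list X) : X :=
  match env with
  | nil => zero
  | x :: l => plus (scal (c O) x) (lincomb (fun n => c (S n)) l)
  end.

(** Recursion over the atoms makes this a finite conjunction that computes, whereas equality of the
    coefficient functions would range over all indices. *)
Fixpoint coefs_agree (c d : nat -> R) (env : list X) : Prop :=
  match env with
  | nil => True
  | _ :: l => c O = d O /\ coefs_agree (fun n => c (S n)) (fun n => d (S n)) l
  end.

Lemma lincomb_ext c d env : coefs_agree c d env -> lincomb c env = lincomb d env.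
Proof.
revert c d; induction env as [|x l IH]; intros c d; simpl; auto.
intros [H H']; rewrite H; f_equal; auto.
Qed.

Lemma lincomb_zero env : lincomb (fun _ => 0) env = zero.
Proof.
induction env as [|x l IH]; simpl; auto.
rewrite IH, plus_zero_r. apply (@scal_zero_l R_AbsRing).
Qed.

Lemma lincomb_scal r c env :
  lincomb (fun n => r * c n) env = scal r (lincomb c env).
Proof.
revert c; induction env as [|x l IH]; intros c; simpl.
- now rewrite scal_zero_r.
- rewrite scal_distr_l, (IH (fun n => c (S n))). f_equal.
  symmetry; apply (@scal_assoc R_AbsRing).
Qed.

Lemma lincomb_plus c d env :
  lincomb (fun n => c n + d n) env = plus (lincomb c env) (lincomb d env).
Proof.
revert c d; induction env as [|x l IH]; intros c d; simpl.
- now rewrite plus_zero_l.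
- rewrite (IH (fun n => c (S n)) (fun n => d (S n))).
  rewrite (scal_distr_r (c O : R_AbsRing) (d O) x : scal (c O + d O) x = _).
  rewrite <- !plus_assoc; f_equal.
  rewrite !plus_assoc; f_equal. apply plus_comm.
Qed.

Lemma lincomb_var m env :
  lincomb (fun n => if Nat.eqb m n then 1 else 0) env = nth m env zero.
Proof.
revert m; induction env as [|x l IH]; intros m; simpl.
- now destruct m.
- destruct m as [|m]; simpl.
  + rewrite lincomb_zero, plus_zero_r. apply (@scal_one R_AbsRing).
  + rewrite (IH m), (@scal_zero_l R_AbsRing). apply plus_zero_l.
Qed.

Lemma veval_lincomb e env : veval env e = lincomb (vcoef e) env.
Proof.
induction e as [n| |a IHa b IHb|a IHa|r a IHa]; simpl.
- now rewrite lincomb_var.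
- now rewrite lincomb_zero.
- now rewrite lincomb_plus, IHa, IHb.
- rewrite IHa, <- scal_opp_one.
  rewrite <- (lincomb_scal (opp (one : R_AbsRing))). apply lincomb_ext.
  generalize (vcoef a); clear; induction env as [|x l IH]; simpl; auto.
  intros c; split; auto. change (opp one : R_AbsRing) with (-1)%R. lra.
- now rewrite lincomb_scal, IHa.
Qed.

Lemma veval_eq env e1 e2 :
  coefs_agree (vcoef e1) (vcoef e2) env -> veval env e1 = veval env e2.
Proof. now rewrite !veval_lincomb; intros; apply lincomb_ext. Qed.

End VectorTactic.

(** The [match goal] around [constr_eq] makes the syntactic test run while the term is being
    computed, so that its failure selects the next branch. *)
Ltac vec_in x l :=
  match l with
  | nil => constr:(false)
  | ?y :: _ => let _ := match goal with _ => constr_eq x y end in constr:(true)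
  | _ :: ?l' => vec_in x l'
  end.

Ltac vec_atoms t l :=
  lazymatch t with
  | zero => l
  | plus ?a ?b => let l := vec_atoms a l in vec_atoms b l
  | minus ?a ?b => let l := vec_atoms a l in vec_atoms b l
  | opp ?a => vec_atoms a l
  | scal _ ?a => vec_atoms a l
  | _ => lazymatch vec_in t l with true => l | false => constr:(t :: l) end
  end.

Ltac vec_index x l :=
  match l with
  | ?y :: _ => let _ := match goal with _ => constr_eq x y end in constr:(O)
  | _ :: ?l' => let n := vec_index x l' in constr:(S n)
  end.

Ltac vec_reify t l :=
  lazymatch t with
  | zero => constr:(VZero)
  | plus ?a ?b =>
      let a := vec_reify a l in let b := vec_reify b l in constr:(VPlus a b)
  | minus ?a ?b =>
      let a := vec_reify a l in let b := vec_reify b l in constr:(VPlus a (VOpp b))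
  | opp ?a => let a := vec_reify a l in constr:(VOpp a)
  | scal ?r ?a => let a := vec_reify a l in constr:(VScal r a)
  | _ => let n := vec_index t l in constr:(VVar n)
  end.

Ltac vec_reduce :=
  lazymatch goal with
  | |- @eq ?T ?a ?b =>
    let l := vec_atoms a (@nil T) in
    let l := vec_atoms b l in
    let ea := vec_reify a l in
    let eb := vec_reify b l in
    refine (@veval_eq _ l ea eb _);
    cbv [coefs_agree vcoef Nat.eqb];
    repeat split
  end.

(** Equalities in a real vector space, up to field identities between scalars. *)
Ltac vec := cbv beta; vec_reduce; try ring; try (field; auto).

(** * Limits *)

Section Limits.
Context {X : CompleteNormedModule R_AbsRing}.

(* Fixing the instances avoids convertible but syntactically different coercion paths,
   on which [rewrite] and [lra] fail. *)
Local Notation zero := (@Hierarchy.zero X).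
Local Notation plus := (@Hierarchy.plus X).
Local Notation opp := (@Hierarchy.opp X).
Local Notation minus := (@Hierarchy.minus X).
Local Notation scal := (@Hierarchy.scal R_AbsRing X).
Local Notation norm := (@Hierarchy.norm R_AbsRing X).
Local Notation sum_n := (@Hierarchy.sum_n X).
Implicit Types x y : X.

Lemma norm_minus_sym x y : norm (minus x y) = norm (minus y x).
Proof. now rewrite <- norm_opp, opp_minus. Qed.

Lemma minus_self x : minus x x = zero.
Proof. exact (plus_opp_r x). Qed.

Lemma minus_plus_plus x y z t :
  minus (plus x y) (plus z t) = plus (minus x z) (minus y t).
Proof. vec. Qed.

Lemma minus_plus_l x y : minus (plus x y) x = y.
Proof. vec. Qed.

Lemma norm_neg x : norm (opp x) = norm x.
Proof. exact (norm_opp x). Qed.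

Lemma norm_0 : norm zero = 0.
Proof. exact norm_zero. Qed.

Lemma norm_minus_self x : norm (minus x x) = 0.
Proof. rewrite minus_self. exact norm_zero. Qed.

Lemma minus_zero_eq x y : minus x y = zero -> x = y.
Proof.
intros H. transitivity (plus (minus x y) y); [vec|]. rewrite H. vec.
Qed.

Lemma norm_scal_le (r : R) x : norm (scal r x) <= Rabs r * norm x.
Proof. exact (norm_scal r x). Qed.

Lemma norm_plus_le x y : norm (plus x y) <= norm x + norm y.
Proof. exact (norm_triangle x y). Qed.

Lemma norm_minus_le x y : norm (minus x y) <= norm x + norm y.
Proof. rewrite <- (norm_opp y). exact (norm_triangle x (opp y)). Qed.

Lemma norm_minus_triangle x y z :
  norm (minus x z) <= norm (minus x y) + norm (minus y z).
Proof.
replace (minus x z) with (plus (minus x y) (minus y z)) by vec.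
apply norm_plus_le.
Qed.

Lemma sum_n_S (d : nat -> X) n : sum_n d (S n) = plus (sum_n d n) (d (S n)).
Proof. exact (sum_Sn d n). Qed.

Lemma sum_n_0 (d : nat -> X) : sum_n d O = d O.
Proof. exact (sum_O d). Qed.

Section Filters.
Context {T : Type} {F : (T -> Prop) -> Prop} {FF : ProperFilter F}.
Implicit Types f g : T -> X.

Lemma lim_norm f x :
  filterlim f F (locally x) <->
  forall eps : R, 0 < eps -> F (fun a => norm (minus (f a) x) < eps).
Proof.
rewrite (@filterlim_locally_ball_norm R_AbsRing T X F _ f x).
split.
- intros H eps He; exact (H (mkposreal eps He)).
- intros H [eps He]; exact (H eps He).
Qed.

Lemma lim_squeeze f x (g : T -> R) :
  F (fun a => norm (minus (f a) x) <= g a) ->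
  filterlim g F (locally 0) -> filterlim f F (locally x).
Proof.
intros H Hg; apply lim_norm; intros eps He.
assert (H1 : F (fun a => Rabs (g a) < eps)).
{ apply (Hg (fun z => Rabs z < eps)).
  exists (mkposreal eps He); intros z Hz.
  replace z with (Hierarchy.minus z 0)
    by (unfold Hierarchy.minus, Hierarchy.plus, Hierarchy.opp; simpl; ring).
  exact Hz. }
generalize (filter_and _ _ H H1); apply filter_imp; intros a [h1 h2].
apply Rle_lt_trans with (1 := h1). apply Rle_lt_trans with (2 := h2).
apply Rle_abs.
Qed.

Lemma lim_plus f g x y :
  filterlim f F (locally x) -> filterlim g F (locally y) ->
  filterlim (fun a => plus (f a) (g a)) F (locally (plus x y)).
Proof.
intros Hf Hg.
exact (@filterlim_comp_2 T X X X F _ _ _ _ f g plus Hf Hg (filterlim_plus x y)).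
Qed.

Lemma lim_scal (r : R) f x :
  filterlim f F (locally x) ->
  filterlim (fun a => scal r (f a)) F (locally (scal r x)).
Proof.
intros Hf. exact (filterlim_comp _ _ _ f _ F _ _ Hf (filterlim_scal_r r x)).
Qed.

Lemma lim_opp f x :
  filterlim f F (locally x) -> filterlim (fun a => opp (f a)) F (locally (opp x)).
Proof.
intros Hf. exact (filterlim_comp _ _ _ f _ F _ _ Hf (filterlim_opp x)).
Qed.

Lemma lim_minus f g x y :
  filterlim f F (locally x) -> filterlim g F (locally y) ->
  filterlim (fun a => minus (f a) (g a)) F (locally (minus x y)).
Proof. intros Hf Hg. apply lim_plus; auto. now apply lim_opp. Qed.

Lemma lim_linear {Y : NormedModule R_AbsRing} (L : X -> Y) f x :
  is_linear L -> filterlim f F (locally x) ->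
  filterlim (fun a => L (f a)) F (locally (L x)).
Proof.
intros HL Hf. exact (filterlim_comp _ _ _ f L F _ _ Hf (linear_cont L x HL)).
Qed.

Lemma lim_unique f x y :
  filterlim f F (locally x) -> filterlim f F (locally y) -> x = y.
Proof. exact (@filterlim_locally_unique T R_AbsRing X F _ f x y). Qed.

Lemma lim_norm_le f x y (C : R) :
  filterlim f F (locally x) -> F (fun a => norm (minus (f a) y) <= C) ->
  norm (minus x y) <= C.
Proof.
intros Hf HC. apply Rnot_lt_le; intros Hlt.
apply (fun H => proj1 (lim_norm f x) H (norm (minus x y) - C)) in Hf; [|lra].
destruct (filter_ex _ (filter_and _ _ Hf HC)) as [a [h1 h2]].
generalize (norm_minus_triangle x (f a) y).
rewrite (norm_minus_sym x (f a)). lra.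
Qed.

End Filters.

Lemma lim_seq_norm (f : nat -> X) x :
  filterlim f eventually (locally x) <->
  is_lim_seq (fun n => norm (minus (f n) x)) 0.
Proof.
split.
- intros H. apply is_lim_seq_spec. intros [eps He].
  generalize (proj1 (lim_norm f x) H eps He). apply filter_imp. intros n Hn.
  simpl. rewrite Rminus_0_r, Rabs_pos_eq; auto. apply norm_ge_0.
- intros H. apply lim_squeeze with (2 := H). apply filter_forall; intros; lra.
Qed.

Lemma is_lim_seq_linear (L : X -> R_NormedModule) (f : nat -> X) x :
  is_linear L -> filterlim f eventually (locally x) ->
  is_lim_seq (fun n => L (f n)) (L x).
Proof. intros HL Hf. exact (lim_linear L f x HL Hf). Qed.

Lemma series_complete (d : nat -> X) (b : nat -> R) :
  (forall n, norm (d n) <= b n) -> ex_series b ->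
  exists x, filterlim (sum_n d) eventually (locally x).
Proof. exact (ex_series_le d b). Qed.

Lemma lim_seq_incr_1 (f : nat -> X) x :
  filterlim f eventually (locally x) ->
  filterlim (fun n => f (S n)) eventually (locally x).
Proof.
rewrite !lim_seq_norm. apply (is_lim_seq_incr_1 (fun n => norm (minus (f n) x))).
Qed.

Lemma seq_complete (u : nat -> X) (b : nat -> R) :
  (forall n, norm (minus (u (S n)) (u n)) <= b n) -> ex_series b ->
  exists x, filterlim u eventually (locally x).
Proof.
intros H Hb. destruct (series_complete _ b H Hb) as [s Hs].
exists (plus s (u O)).
assert (E : forall n, plus (sum_n (fun n => minus (u (S n)) (u n)) n) (u O) = u (S n)).
{ induction n as [|n IH].
  - rewrite sum_n_0. vec.
  - rewrite sum_n_S. transitivity (plus (minus (u (S (S n))) (u (S n))) (u (S n))); [|vec].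
    rewrite <- IH at 3. vec. }
assert (H1 : filterlim (fun n => u (S n)) eventually (locally (plus s (u O)))).
{ eapply filterlim_ext; [exact E|]. apply lim_plus; auto. apply filterlim_const. }
apply lim_seq_norm. apply is_lim_seq_incr_1. now apply lim_seq_norm in H1.
Qed.

End Limits.

Lemma is_lim_seq_le_real (u v : nat -> R) (a b : R) :
  (forall n, u n <= v n) -> is_lim_seq u a -> is_lim_seq v b -> a <= b.
Proof. intros H Hu Hv. exact (is_lim_seq_le u v a b H Hu Hv). Qed.

Lemma is_lim_seq_unique_real (u : nat -> R) (a b : R) :
  is_lim_seq u a -> is_lim_seq u b -> a = b.
Proof.
intros Ha Hb. apply is_lim_seq_unique in Ha, Hb. congruence.
Qed.

Lemma ex_series_geom_scal (C q : R) : 0 <= q < 1 -> ex_series (fun n => C * q ^ n).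
Proof.
intros H. apply (ex_series_scal C (fun n => q ^ n)).
apply ex_series_geom. rewrite Rabs_pos_eq; lra.
Qed.

(** * Decomposition into positive elements *)

Section Cone.
Context {X : CompleteNormedModule R_AbsRing} {P : X -> Prop} {Psi : X -> R}
  (HX : is_abstract_state_space P) (HPsi : is_norm_functional P Psi).

Local Notation zero := (@Hierarchy.zero X).
Local Notation plus := (@Hierarchy.plus X).
Local Notation opp := (@Hierarchy.opp X).
Local Notation minus := (@Hierarchy.minus X).
Local Notation scal := (@Hierarchy.scal R_AbsRing X).
Local Notation norm := (@Hierarchy.norm R_AbsRing X).
Local Notation sum_n := (@Hierarchy.sum_n X).

Lemma cone_zero : P zero.
Proof.
destruct (cone_generating HX zero) as (u & _ & Hu & _).
assert (E : scal 0 u = zero) by vec.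
exact (eq_ind _ P (cone_scal HX (Rle_refl 0) Hu) _ E).
Qed.

Lemma cone_lim {T} {F : (T -> Prop) -> Prop} {FF : ProperFilter F} (f : T -> X) x :
  filterlim f F (locally x) -> F (fun a => P (f a)) -> P x.
Proof.
intros Hf HP. exact (closed_filterlim_loc f P x Hf HP (cone_closed HX)).
Qed.

Lemma cone_le_trans x y z : P (minus y x) -> P (minus z y) -> P (minus z x).
Proof.
intros H1 H2. replace (minus z x) with (plus (minus z y) (minus y x)) by vec.
now apply (cone_plus HX).
Qed.

Lemma cone_le_antisym x y : P (minus y x) -> P (minus x y) -> x = y.
Proof.
intros H1 H2. apply minus_zero_eq,  (cone_pointed HX); auto. now rewrite opp_minus.
Qed.

Lemma cone_sum_n (d : nat -> X) n : (forall k, P (d k)) -> P (sum_n d n).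
Proof.
intros H; induction n as [|n IH]; [rewrite sum_n_0|rewrite sum_n_S]; auto.
now apply (cone_plus HX).
Qed.

Lemma Psi_linear : is_linear (Psi : X -> R_NormedModule).
Proof. exact (proj1 HPsi). Qed.

Lemma Psi_norm u : P u -> Psi u = norm u.
Proof. exact (proj2 HPsi u). Qed.

Lemma Psi_plus x y : Psi (plus x y) = Psi x + Psi y.
Proof. exact (linear_plus _ Psi_linear x y). Qed.

Lemma Psi_scal (r : R) x : Psi (scal r x) = r * Psi x.
Proof. exact (linear_scal _ Psi_linear r x). Qed.

Lemma Psi_opp x : Psi (opp x) = - Psi x.
Proof. replace (opp x) with (scal (-1) x) by vec. rewrite Psi_scal. ring. Qed.

Lemma Psi_minus x y : Psi (minus x y) = Psi x - Psi y.
Proof. unfold minus. rewrite Psi_plus, Psi_opp. reflexivity. Qed.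

Lemma Psi_nonneg u : P u -> 0 <= Psi u.
Proof. intros H; rewrite Psi_norm by auto. apply norm_ge_0. Qed.

Lemma Psi_lim (f : nat -> X) x :
  filterlim f eventually (locally x) -> is_lim_seq (fun n => Psi (f n)) (Psi x).
Proof. apply (is_lim_seq_linear Psi), Psi_linear. Qed.

(** [cone_ball x r] says that [x] has base norm at most [r], up to attainment of
    the infimum. *)
Definition cone_ball (x : X) (r : R) : Prop :=
  exists u v, P u /\ P v /\ x = minus u v /\ norm u + norm v <= r.

Lemma cone_ball_norm x r : cone_ball x r -> norm x <= r.
Proof.
intros (u & v & Hu & Hv & -> & H). apply Rle_trans with (2 := H).
apply norm_minus_le.
Qed.

Lemma cone_ball_nonneg x r : cone_ball x r -> 0 <= r.
Proof. intros H. apply Rle_trans with (norm x); [apply norm_ge_0|now apply cone_ball_norm]. Qed.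

Lemma cone_ball_le x r s : r <= s -> cone_ball x r -> cone_ball x s.
Proof. intros H (u & v & Hu & Hv & E & H'). exists u, v. repeat split; auto; lra. Qed.

Lemma cone_ball_opp x r : cone_ball x r -> cone_ball (opp x) r.
Proof.
intros (u & v & Hu & Hv & -> & H). exists v, u.
repeat split; auto; [vec|lra].
Qed.

Lemma cone_ball_plus x y r s :
  cone_ball x r -> cone_ball y s -> cone_ball (plus x y) (r + s).
Proof.
intros (u & v & Hu & Hv & -> & H) (u' & v' & Hu' & Hv' & -> & H').
exists (plus u u'), (plus v v'); repeat split; try now apply (cone_plus HX).
- vec.
- rewrite !(cone_norm_additive HX); auto; lra.
Qed.

Lemma cone_ball_minus x y r s :
  cone_ball x r -> cone_ball y s -> cone_ball (minus x y) (r + s).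
Proof. intros Hx Hy. apply cone_ball_plus; auto. now apply cone_ball_opp. Qed.

Lemma cone_norm_scal (c : R) u : 0 <= c -> P u -> norm (scal c u) = c * norm u.
Proof.
intros Hc Hu. rewrite <- (Psi_norm (scal c u)), Psi_scal, Psi_norm; auto.
now apply (cone_scal HX).
Qed.

Lemma cone_ball_scal (c : R) x r : 0 <= c -> cone_ball x r -> cone_ball (scal c x) (c * r).
Proof.
intros Hc (u & v & Hu & Hv & -> & H).
exists (scal c u), (scal c v); repeat split; try now apply (cone_scal HX).
- vec.
- rewrite !cone_norm_scal by auto. rewrite <- Rmult_plus_distr_l.
  now apply Rmult_le_compat_l.
Qed.

Lemma cone_ball_ex x : exists n : nat, cone_ball x (INR n).
Proof.
destruct (cone_generating HX x) as (u & v & Hu & Hv & E).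
destruct (nfloor_ex (norm u + norm v)) as [n Hn].
{ apply Rplus_le_le_0_compat; apply norm_ge_0. }
exists (S n), u, v. rewrite S_INR. repeat split; auto; lra.
Qed.

(** Membership in the norm closure of the base-norm ball of radius [r]; the Baire argument gives
    information on closures only. *)
Definition approximable (x : X) (r : R) : Prop :=
  forall eps, 0 < eps -> exists k, cone_ball k r /\ norm (minus x k) < eps.

(* Baire: otherwise there are nested balls, the [n]-th one avoiding the closure of
   the set of [x] with [cone_ball x (INR n)]; their common point contradicts that
   the cone generates. *)
Lemma cone_ball_somewhere_dense :
  exists (n : nat) (x0 : X) (delta : R), 0 < delta /\
    forall x : X, norm (minus x x0) < delta -> approximable x (INR n).
Proof.
apply NNPP; intros Hno.
assert (Hstep : forall (n : nat) (b : X * posreal), exists c : X * posreal,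
  norm (minus (fst c) (fst b)) + snd c <= snd b / 2 /\
  forall k, cone_ball k (INR n) -> snd c < norm (minus (fst c) k)).
{ intros n [x0 delta]; simpl.
  apply NNPP; intros Hc. apply Hno. exists n, x0, (delta / 4).
  split; [destruct delta; simpl; lra|].
  intros x Hx eps He. apply NNPP; intros Hk. apply Hc.
  (* The first bound on the new radius keeps the new ball away from the set, since [x] has distance
     at least [eps] to it; with the second, radius and displacement of the centre add up to at most
     half of the old radius. *)
  assert (Hd : 0 < Rmin (eps / 2) (delta / 4)).
  { destruct delta as [d Hd]; simpl in *. apply Rmin_glb_lt; lra. }
  exists (x, mkposreal _ Hd); simpl.
  generalize (Rmin_l (eps / 2) (delta / 4)) (Rmin_r (eps / 2) (delta / 4)).
  destruct delta as [d Hd']; simpl in *.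
  intros h1 h2; repeat split; try lra.
  intros k Hk'. apply Rlt_le_trans with eps; [lra|].
  apply Rnot_lt_le; intros Hlt; apply Hk; now exists k. }
assert (Hseq : exists (y : nat -> X) (d : nat -> R), d O = 1 /\ (forall n, 0 < d n) /\
  forall n, norm (minus (y (S n)) (y n)) + d (S n) <= d n / 2 /\
    forall k, cone_ball k (INR n) -> d (S n) < norm (minus (y (S n)) k)).
{ set (next := fun n b => proj1_sig (constructive_indefinite_description _ (Hstep n b))).
  set (b := nat_rect (fun _ => (X * posreal)%type) (zero, mkposreal 1 Rlt_0_1) next).
  exists (fun n => fst (b n)), (fun n => snd (b n)).
  split; [reflexivity|]. split; [intros n; apply cond_pos|].
  intros n. exact (proj2_sig (constructive_indefinite_description _ (Hstep n (b n)))). }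
destruct Hseq as (y & d & Hd0 & Hd & Hy).
assert (Hrad : forall n, d n <= (/ 2) ^ n).
{ induction n as [|n IH]; simpl; [lra|].
  destruct (Hy n) as (h & _). generalize (norm_ge_0 (minus (y (S n)) (y n))). lra. }
destruct (seq_complete y (fun n => 1 * (/ 2) ^ n)) as [x Hx].
{ intros n. destruct (Hy n) as (h & _). generalize (Hrad n) (Hd (S n)) (Hd n). lra. }
{ apply ex_series_geom_scal; lra. }
assert (Hfar : forall n, norm (minus x (y n)) <= d n).
{ intros n.
  assert (Hin : forall m, norm (minus (y (m + n)%nat) (y n)) + d (m + n)%nat <= d n).
  { induction m as [|m IH]; simpl.
    - rewrite norm_minus_self; lra.
    - destruct (Hy (m + n)%nat) as (h & _).
      generalize (norm_minus_triangle (y (S (m + n))) (y (m + n)%nat) (y n)) (Hd (m + n)%nat).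
      lra. }
  apply (lim_norm_le (F := eventually) y); auto.
  exists n; intros m Hm. generalize (Hin (m - n)%nat) (Hd (m - n + n)%nat).
  replace (m - n + n)%nat with m by lia. lra. }
destruct (cone_ball_ex x) as [n Hn].
destruct (Hy n) as (_ & h). generalize (h x Hn) (Hfar (S n)).
rewrite norm_minus_sym. lra.
Qed.

Lemma approximable_minus x y r s :
  approximable x r -> approximable y s -> approximable (minus x y) (r + s).
Proof.
intros Hx Hy eps He.
destruct (Hx (eps / 2)) as (k & Hk & h); [lra|].
destruct (Hy (eps / 2)) as (k' & Hk' & h'); [lra|].
exists (minus k k'); split; [now apply cone_ball_minus|].
replace (minus (minus x y) (minus k k')) with (minus (minus x k) (minus y k')) by vec.
eapply Rle_lt_trans; [apply norm_minus_le|]. lra.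
Qed.

(** Differences of approximable points turn the ball around [x0] into one around the origin, and
    homogeneity spreads the result over [X]. The relative error one half drives the successive
    approximation in [cone_ball_bound]. *)
Lemma cone_ball_approx :
  exists C, 0 < C /\ forall x, exists k,
    cone_ball k (C * norm x) /\ norm (minus x k) <= norm x / 2.
Proof.
destruct cone_ball_somewhere_dense as (n & x0 & d & Hd & H).
assert (H0 : forall x, norm x < d -> approximable x (INR n + INR n)).
{ intros x Hx. replace x with (minus (plus x0 x) x0) by vec.
  apply approximable_minus; apply H.
  - replace (minus (plus x0 x) x0) with x by vec. auto.
  - now rewrite norm_minus_self. }
set (N := INR n + INR n) in *.
assert (HN : 0 <= N) by (generalize (pos_INR n); unfold N; lra).
(* The vector is rescaled to norm [d / 2], which costs the factor [2 / d]; then an error below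
   [d / 4] becomes half of the original norm. [N + 1] in place of [N] keeps the constant
   positive. *)
exists ((N + 1) * 2 / d). split.
{ apply Rdiv_lt_0_compat; lra. }
intros x. destruct (norm_ge_0 x) as [Hx|Hx].
- set (c := 2 * norm x / d).
  assert (Hc : 0 < c) by (unfold c; apply Rdiv_lt_0_compat; lra).
  destruct (H0 (scal (/ c) x)) with (eps := d / 4) as (k & Hk & Hd').
  { eapply Rle_lt_trans; [apply norm_scal_le|].
    rewrite Rabs_pos_eq by (left; now apply Rinv_0_lt_compat).
    unfold c. replace (/ (2 * norm x / d) * norm x) with (d / 2) by (field; lra). lra. }
  { lra. }
  exists (scal c k). split.
  + apply cone_ball_le with (c * N).
    { unfold c. replace ((N + 1) * 2 / d * norm x) with (2 * norm x / d * N + 2 * norm x / d) by (field; lra).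
      fold c. lra. }
    apply cone_ball_scal; auto; lra.
  + replace (minus x (scal c k)) with (scal c (minus (scal (/ c) x) k)) by (vec; lra).
    eapply Rle_trans; [apply norm_scal_le|].
    rewrite Rabs_pos_eq by lra.
    apply Rle_trans with (c * (d / 4)).
    { apply Rmult_le_compat_l; [lra|]. left; exact Hd'. }
    unfold c. right. field. lra.
- exists zero. split.
  + exists zero, zero. repeat split; try apply cone_zero.
    * now rewrite minus_self.
    * rewrite <- Hx, norm_0. lra.
  + assert (E : x = zero) by exact (norm_eq_zero x (eq_sym Hx)).
    rewrite E, norm_minus_self, norm_0; lra.
Qed.

Lemma cone_series (d : nat -> X) (C : R) (q : R) : 0 <= q < 1 ->
  (forall n, P (d n)) -> (forall n, norm (d n) <= C * q ^ n) ->
  exists x, filterlim (sum_n d) eventually (locally x) /\ P x /\ norm x <= C / (1 - q).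
Proof.
intros Hq HP Hd.
destruct (series_complete d (fun n => C * q ^ n)) as [x Hx]; auto.
{ now apply ex_series_geom_scal. }
exists x.
assert (Px : P x).
{ apply (cone_lim (F := eventually) (sum_n d)); auto.
  apply filter_forall; intros n; now apply cone_sum_n. }
repeat split; auto.
rewrite <- (Psi_norm x) by auto.
apply is_lim_seq_le_real with (3 := is_lim_seq_const _) (2 := Psi_lim _ _ Hx).
intros n.
assert (HC : 0 <= C).
{ generalize (Hd O) (norm_ge_0 (d O)); simpl; lra. }
assert (HS : Psi (sum_n d n) <= C * ((1 - q ^ S n) / (1 - q))).
{ induction n as [|n IH].
  - rewrite sum_n_0, Psi_norm; auto. generalize (Hd O). simpl.
    replace ((1 - q * 1) / (1 - q)) with 1 by (field; lra). lra.
  - rewrite sum_n_S, Psi_plus, (Psi_norm (d (S n))); auto.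
    generalize (Hd (S n)).
    replace (C * ((1 - q ^ S (S n)) / (1 - q)))
      with (C * ((1 - q ^ S n) / (1 - q)) + C * q ^ S n); [lra|].
    simpl. field. lra. }
apply Rle_trans with (1 := HS). unfold Rdiv.
apply Rmult_le_compat_l; auto.
rewrite <- (Rmult_1_l (/ (1 - q))) at 2.
apply Rmult_le_compat_r.
- left; apply Rinv_0_lt_compat; lra.
- generalize (pow_le q (S n)); lra.
Qed.

(** Successive approximation, as in the open mapping theorem: each residual is at most half of the
    previous one, and the positive and negative parts are summed separately. Each of the two series
    has norm at most [C * norm x / (1 - / 2)], whence [4 * C]. *)
Theorem cone_ball_bound :
  exists M, 0 < M /\ forall x, cone_ball x (M * norm x).
Proof.
destruct cone_ball_approx as (C & HC & H).
exists (4 * C). split; [lra|]. intros x.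
assert (H' : forall y, exists p : X * X, P (fst p) /\ P (snd p) /\
  norm (fst p) + norm (snd p) <= C * norm y /\
  norm (minus y (minus (fst p) (snd p))) <= norm y / 2).
{ intros y. destruct (H y) as (k & (u & v & Hu & Hv & -> & h) & h').
  exists (u, v); auto. }
set (p := fun y => proj1_sig (constructive_indefinite_description _ (H' y))).
assert (Hp : forall y, P (fst (p y)) /\ P (snd (p y)) /\
  norm (fst (p y)) + norm (snd (p y)) <= C * norm y /\
  norm (minus y (minus (fst (p y)) (snd (p y)))) <= norm y / 2).
{ intros y. exact (proj2_sig (constructive_indefinite_description _ (H' y))). }
set (r := fix r n := match n with O => x | S n => minus (r n) (minus (fst (p (r n))) (snd (p (r n)))) end).
assert (Hr : forall n, norm (r n) <= norm x * (/ 2) ^ n).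
{ induction n as [|n IH]; simpl; [lra|].
  destruct (Hp (r n)) as (_ & _ & _ & h). lra. }
assert (Hb : forall n, norm (fst (p (r n))) <= C * norm x * (/ 2) ^ n /\
                       norm (snd (p (r n))) <= C * norm x * (/ 2) ^ n).
{ intros n. destruct (Hp (r n)) as (_ & _ & h & _).
  assert (h2 : C * norm (r n) <= C * norm x * (/ 2) ^ n).
  { rewrite Rmult_assoc. apply Rmult_le_compat_l; [lra|auto]. }
  generalize (norm_ge_0 (fst (p (r n)))) (norm_ge_0 (snd (p (r n)))). lra. }
destruct (cone_series (fun n => fst (p (r n))) (C * norm x) (/ 2)) as (u & Lu & Pu & Nu).
{ lra. } { intros; apply Hp. } { intros; apply Hb. }
destruct (cone_series (fun n => snd (p (r n))) (C * norm x) (/ 2)) as (v & Lv & Pv & Nv).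
{ lra. } { intros; apply Hp. } { intros; apply Hb. }
exists u, v. repeat split; auto.
- assert (E : forall n, minus (sum_n (fun n => fst (p (r n))) n) (sum_n (fun n => snd (p (r n))) n) = minus x (r (S n))).
  { induction n as [|n IH].
    - rewrite !sum_n_0. simpl. vec.
    - rewrite !sum_n_S. change (r (S (S n))) with (minus (r (S n)) (minus (fst (p (r (S n)))) (snd (p (r (S n)))))).
      rewrite minus_plus_plus, IH. vec. }
  assert (L1 := lim_minus _ _ _ _ Lu Lv).
  apply (lim_unique (F := eventually)) with (2 := L1).
  apply (lim_squeeze (F := eventually)) with (fun n => norm x * (/ 2) ^ (S n)).
  + apply filter_forall; intros n. rewrite E.
    replace (minus (minus x (r (S n))) x) with (opp (r (S n))) by vec.
    rewrite norm_neg. apply Hr.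
  + assert (L2 : is_lim_seq (fun n => norm x * (/ 2) ^ n) (norm x * 0)).
    { apply (is_lim_seq_scal_l _ (norm x) 0). apply is_lim_seq_geom.
      rewrite Rabs_pos_eq; lra. }
    rewrite Rmult_0_r in L2. apply is_lim_seq_incr_1 in L2. exact L2.
- lra.
Qed.

End Cone.

(** * Positive maps *)

(** [c] bounds [L] on the cone only; on all of [X] the bound is [c] times the
    constant of [cone_ball_bound]. *)
Record positive_map {X : CompleteNormedModule R_AbsRing} (P : X -> Prop)
    (c : R) (L : X -> X) : Prop := {
  pm_plus : forall x y : X, L (@plus X x y) = @plus X (L x) (L y);
  pm_scal : forall (r : R) (x : X), L (@scal R_AbsRing X r x) = @scal R_AbsRing X r (L x);
  pm_pos : forall u, P u -> P (L u);
  pm_bound : forall u, P u -> norm (L u) <= c * norm u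
}.

Section PositiveMaps.
Context {X : CompleteNormedModule R_AbsRing} {P : X -> Prop} {Psi : X -> R}
  (HX : is_abstract_state_space P) (HPsi : is_norm_functional P Psi).

Local Notation zero := (@Hierarchy.zero X).
Local Notation plus := (@Hierarchy.plus X).
Local Notation opp := (@Hierarchy.opp X).
Local Notation minus := (@Hierarchy.minus X).
Local Notation scal := (@Hierarchy.scal R_AbsRing X).
Local Notation norm := (@Hierarchy.norm R_AbsRing X).
Local Notation sum_n := (@Hierarchy.sum_n X).

Lemma pm_opp c L : positive_map P c L -> forall x, L (opp x) = opp (L x).
Proof.
intros HL x. replace (opp x) with (scal (-1) x) by vec.
rewrite (pm_scal _ _ _ HL). vec.
Qed.

Lemma pm_minus c L :
  positive_map P c L -> forall x y, L (minus x y) = minus (L x) (L y).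
Proof.
intros HL x y. exact (eq_trans (pm_plus _ _ _ HL x (opp y))
  (f_equal (plus (L x)) (pm_opp _ _ HL y))).
Qed.

Lemma pm_cone_ball c L x r :
  0 <= c -> positive_map P c L -> cone_ball (P := P) x r -> cone_ball (P := P) (L x) (c * r).
Proof.
intros Hc HL (u & v & Hu & Hv & -> & H).
exists (L u), (L v). repeat split; try now apply (pm_pos _ _ _ HL).
- now rewrite (pm_minus _ _ HL).
- generalize (pm_bound _ _ _ HL u Hu) (pm_bound _ _ _ HL v Hv).
  assert (c * (norm u + norm v) <= c * r) by now apply Rmult_le_compat_l. lra.
Qed.

(** The order of the quantifiers is the point: [M] depends on the cone alone, so cone contractions
    and all their iterates form an equicontinuous family. *)
Lemma pm_norm_bound : exists M, 0 < M /\
  forall c L x, 0 <= c -> positive_map P c L -> norm (L x) <= M * c * norm x.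
Proof.
destruct (cone_ball_bound HX HPsi) as (M & HM & H).
exists M; split; auto. intros c L x Hc HL.
replace (M * c * norm x) with (c * (M * norm x)) by ring.
apply (cone_ball_norm (P := P)). now apply pm_cone_ball.
Qed.

Lemma pm_linear c L : 0 <= c -> positive_map P c L -> is_linear L.
Proof.
intros Hc HL. destruct pm_norm_bound as (M & HM & H). split.
- apply (pm_plus _ _ _ HL).
- apply (pm_scal _ _ _ HL).
(* [is_linear] asks for a positive constant, and [c] may be zero. *)
- exists (M * (c + 1)). split; [nra|]. intros x.
  generalize (H c L x Hc HL) (norm_ge_0 x). intros h1 h2.
  assert (0 <= M * norm x) by nra. apply Rle_trans with (1 := h1). nra.
Qed.

Lemma pm_id : positive_map P 1 (fun x => x).
Proof. split; auto; intros; lra. Qed.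

Lemma pm_comp c d L K : 0 <= c ->
  positive_map P c L -> positive_map P d K -> positive_map P (c * d) (fun x => L (K x)).
Proof.
intros Hc HL HK; split; intros.
- now rewrite (pm_plus _ _ _ HK), (pm_plus _ _ _ HL).
- now rewrite (pm_scal _ _ _ HK), (pm_scal _ _ _ HL).
- now apply (pm_pos _ _ _ HL), (pm_pos _ _ _ HK).
- apply Rle_trans with (1 := pm_bound _ _ _ HL _ (pm_pos _ _ _ HK _ H)).
  rewrite Rmult_assoc. apply Rmult_le_compat_l; auto. now apply (pm_bound _ _ _ HK).
Qed.

Lemma pm_comp1 L K :
  positive_map P 1 L -> positive_map P 1 K -> positive_map P 1 (fun x => L (K x)).
Proof. intros HL HK. rewrite <- (Rmult_1_l 1). apply pm_comp; auto; lra. Qed.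

Lemma pm_iter L n : positive_map P 1 L -> positive_map P 1 (Nat.iter n L).
Proof.
intros HL. induction n as [|n IH]; [apply pm_id|]. exact (pm_comp1 _ _ HL IH).
Qed.

Lemma pm_scale c L (r : R) : 0 <= r ->
  positive_map P c L -> positive_map P (r * c) (fun x => scal r (L x)).
Proof.
intros Hr HL; split; intros.
- rewrite (pm_plus _ _ _ HL). vec.
- rewrite (pm_scal _ _ _ HL). vec.
- now apply (cone_scal HX), (pm_pos _ _ _ HL).
- rewrite (cone_norm_scal HX HPsi), Rmult_assoc; auto.
  + apply Rmult_le_compat_l; auto. now apply (pm_bound _ _ _ HL).
  + now apply (pm_pos _ _ _ HL).
Qed.

Lemma pm_lim {T} {F : (T -> Prop) -> Prop} {FF : ProperFilter F} c (f : T -> X -> X) (g : X -> X) :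
  F (fun a => positive_map P c (f a)) ->
  (forall x, filterlim (fun a => f a x) F (locally (g x))) -> positive_map P c g.
Proof.
intros Hf Hg. split; intros.
- apply (lim_unique (F := F) (fun a => f a (plus x y))); auto.
  apply filterlim_ext_loc with (fun a => plus (f a x) (f a y)).
  + revert Hf; apply filter_imp; intros a Ha; symmetry; apply (pm_plus _ _ _ Ha).
  + now apply lim_plus.
- apply (lim_unique (F := F) (fun a => f a (scal r x))); auto.
  apply filterlim_ext_loc with (fun a => scal r (f a x)).
  + revert Hf; apply filter_imp; intros a Ha; symmetry; apply (pm_scal _ _ _ Ha).
  + now apply lim_scal.
- apply (cone_lim HX (F := F) (fun a => f a u)); auto.
  revert Hf; apply filter_imp; intros a Ha; now apply (pm_pos _ _ _ Ha).
- replace (g u) with (minus (g u) zero) by vec.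
  apply (lim_norm_le (F := F) (fun a => f a u)); auto.
  revert Hf; apply filter_imp; intros a Ha.
  replace (minus (f a u) zero) with (f a u) by vec.
  now apply (pm_bound _ _ _ Ha).
Qed.

Definition dense (D : X -> Prop) : Prop :=
  forall x (eps : R), 0 < eps -> exists w, D w /\ norm (minus x w) < eps.

Lemma dense_incl (D D' : X -> Prop) : (forall x, D x -> D' x) -> dense D -> dense D'.
Proof. intros H HD x eps He. destruct (HD x eps He) as (w & Hw & h). exists w; auto. Qed.

(** A three-epsilon argument: the common bound [M * c] controls both maps on the difference between
    [x] and a nearby point of [D]. The [+ 1] in the tolerance covers [c = 0]. *)
Lemma pm_lim_dense {T} {F : (T -> Prop) -> Prop} {FF : ProperFilter F} c
    (f : T -> X -> X) (g : X -> X) (D : X -> Prop) :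
  0 <= c -> F (fun a => positive_map P c (f a)) -> positive_map P c g -> dense D ->
  (forall w, D w -> filterlim (fun a => f a w) F (locally (g w))) ->
  forall x, filterlim (fun a => f a x) F (locally (g x)).
Proof.
intros Hc Hf Hg HD H x. apply lim_norm. intros eps He.
destruct pm_norm_bound as (M & HM & HB).
destruct (HD x (eps / (3 * (M * c + 1)))) as (w & Hw & Hxw).
{ apply Rdiv_lt_0_compat; auto. nra. }
assert (Hsmall : M * c * norm (minus x w) <= eps / 3).
{ apply Rle_trans with ((M * c + 1) * (eps / (3 * (M * c + 1)))).
  - apply Rmult_le_compat; try lra; try nra. apply norm_ge_0.
  - right. field. nra. }
assert (Hw' := proj1 (lim_norm (F := F) _ _) (H w Hw) (eps / 3) ltac:(lra)).
generalize (filter_and _ _ Hf Hw'). apply filter_imp. intros a [h1 h2].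
replace (minus (f a x) (g x)) with
  (plus (f a (minus x w)) (minus (minus (f a w) (g w)) (g (minus x w)))).
2: { rewrite (pm_minus _ _ h1), (pm_minus _ _ Hg). vec. }
eapply Rle_lt_trans; [apply norm_plus_le|].
generalize (norm_minus_le (minus (f a w) (g w)) (g (minus x w)))
  (HB c (f a) (minus x w) Hc h1) (HB c g (minus x w) Hc Hg). lra.
Qed.

Lemma cauchy_complete (u : nat -> X) :
  (forall eps, 0 < eps -> exists N, forall n m, (N <= n)%nat -> (N <= m)%nat ->
     norm (minus (u n) (u m)) < eps) ->
  exists x, filterlim u eventually (locally x).
Proof.
intros H. apply (proj1 (@filterlim_locally_cauchy _ X eventually _ u)).
intros [eps He]. destruct (H eps He) as (N & HN).
exists (fun n => (N <= n)%nat). split; [now exists N|].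
intros n m Hn Hm. apply (norm_compat1 (u n) (u m)). now apply HN.
Qed.

Lemma lim_cauchy (u : nat -> X) x : filterlim u eventually (locally x) ->
  forall eps, 0 < eps -> exists N, forall n m, (N <= n)%nat -> (N <= m)%nat ->
     norm (minus (u n) (u m)) < eps.
Proof.
intros H eps He. destruct (proj1 (lim_norm (F := eventually) _ _) H (eps / 2) ltac:(lra)) as (N & HN).
exists N. intros n m Hn Hm.
generalize (norm_minus_triangle (u n) x (u m)) (HN n Hn) (HN m Hm).
rewrite (norm_minus_sym x). lra.
Qed.

(** With no candidate for the limit map, the three-epsilon argument is run on the Cauchy property
    instead. *)
Lemma pm_ex_lim_dense c (f : nat -> X -> X) (D : X -> Prop) :
  0 <= c -> (forall n, positive_map P c (f n)) -> dense D ->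
  (forall w, D w -> exists y, filterlim (fun n => f n w) eventually (locally y)) ->
  forall x, exists y, filterlim (fun n => f n x) eventually (locally y).
Proof.
intros Hc Hf HD H x. apply cauchy_complete. intros eps He.
destruct pm_norm_bound as (M & HM & HB).
destruct (HD x (eps / (3 * (M * c + 1)))) as (w & Hw & Hxw).
{ apply Rdiv_lt_0_compat; auto. nra. }
assert (Hsmall : M * c * norm (minus x w) <= eps / 3).
{ apply Rle_trans with ((M * c + 1) * (eps / (3 * (M * c + 1)))).
  - apply Rmult_le_compat; try lra; try nra. apply norm_ge_0.
  - right. field. nra. }
destruct (H w Hw) as (y & Hy).
destruct (lim_cauchy _ _ Hy (eps / 3)) as (N & HN); [lra|].
exists N. intros n m Hn Hm.
replace (minus (f n x) (f m x)) with
  (plus (f n (minus x w)) (minus (minus (f n w) (f m w)) (f m (minus x w)))).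
2: { rewrite (pm_minus _ _ (Hf n)), (pm_minus _ _ (Hf m)). vec. }
eapply Rle_lt_trans; [apply norm_plus_le|].
generalize (norm_minus_le (minus (f n w) (f m w)) (f m (minus x w))) (HN n m Hn Hm)
  (HB c (f n) (minus x w) Hc (Hf n)) (HB c (f m) (minus x w) Hc (Hf m)). lra.
Qed.

(* The diagonal limit: uniform boundedness makes [f a] equicontinuous. *)
Lemma pm_lim_comp {T} {F : (T -> Prop) -> Prop} {FF : ProperFilter F} c
    (f : T -> X -> X) (h : T -> X) x y :
  0 <= c -> F (fun a => positive_map P c (f a)) ->
  filterlim h F (locally x) -> filterlim (fun a => f a x) F (locally y) ->
  filterlim (fun a => f a (h a)) F (locally y).
Proof.
intros Hc Hf Hh Hy. destruct pm_norm_bound as (M & HM & HB).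
apply filterlim_ext_loc with (fun a => plus (f a (minus (h a) x)) (f a x)).
{ revert Hf; apply filter_imp. intros a Ha. rewrite (pm_minus _ _ Ha). vec. }
replace y with (plus zero y) by vec. apply lim_plus; auto.
apply lim_norm. intros eps He.
assert (Hd : 0 < eps / (M * c + 1)) by (apply Rdiv_lt_0_compat; nra).
generalize (filter_and _ _ Hf (proj1 (lim_norm (F := F) _ _) Hh _ Hd)).
apply filter_imp. intros a [h1 h2].
replace (minus (f a (minus (h a) x)) zero) with (f a (minus (h a) x)) by vec.
apply Rle_lt_trans with (1 := HB c (f a) _ Hc h1).
apply Rle_lt_trans with (M * c * (eps / (M * c + 1))).
{ apply Rmult_le_compat_l; [nra|lra]. }
apply Rlt_le_trans with ((M * c + 1) * (eps / (M * c + 1))).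
{ apply Rmult_lt_compat_r; lra. }
right; field. nra.
Qed.

Lemma pm_eq_cone c d L K : positive_map P c L -> positive_map P d K ->
  (forall u, P u -> L u = K u) -> forall x, L x = K x.
Proof.
intros HL HK H x. destruct (cone_generating HX x) as (u & v & Hu & Hv & ->).
rewrite (pm_minus _ _ HL), (pm_minus _ _ HK). now rewrite !H.
Qed.

End PositiveMaps.

(** * Integrals of orbits *)

Section ConeIntegral.
Context {X : CompleteNormedModule R_AbsRing} {P : X -> Prop}
  (HX : is_abstract_state_space P).

Local Notation zero := (@Hierarchy.zero X).
Local Notation plus := (@Hierarchy.plus X).
Local Notation opp := (@Hierarchy.opp X).
Local Notation minus := (@Hierarchy.minus X).
Local Notation scal := (@Hierarchy.scal R_AbsRing X).
Local Notation norm := (@Hierarchy.norm R_AbsRing X).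
Local Notation sum_n := (@Hierarchy.sum_n X).

Lemma Riemann_sum_cone (f : R -> X) ptd :
  (forall s, P (f s)) -> pointed_subdiv ptd -> P (Riemann_sum f ptd).
Proof.
intros Hf. apply SF_cons_ind with (s := ptd); clear ptd.
- intros x0 _. exact (cone_zero HX).
- intros h ptd IH H.
  rewrite (Riemann_sum_cons (V := X) f h ptd). apply (cone_plus HX).
  + apply (cone_scal HX); auto.
    assert (H0 : (0 < SF_size (SF_cons h ptd))%nat).
    { rewrite SF_size_cons. apply Nat.lt_0_succ. }
    generalize (H O H0). rewrite SF_lx_cons. simpl. lra.
  + apply IH. now apply ptd_cons with h.
Qed.

Lemma is_RInt_cone (f : R -> X) a b v :
  a <= b -> (forall s, a <= s <= b -> P (f s)) -> is_RInt f a b v -> P v.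
Proof.
(* [Riemann_sum_cone] asks for positivity at every real, so [f] is clamped to the interval, which
   leaves the integral unchanged. *)
intros Hab Hf' Hv'. set (g := fun s => f (Rmax a (Rmin b s))).
assert (Hf : forall s, P (g s)).
{ intros s. apply Hf'. unfold Rmax, Rmin; repeat destruct Rle_dec; lra. }
assert (Hv : is_RInt g a b v).
{ apply is_RInt_ext with (2 := Hv'). intros s. rewrite Rmin_left, Rmax_right by auto.
  intros Hs. unfold g. now rewrite Rmin_right, Rmax_right by lra. }
clearbody g. clear f Hf' Hv'.
apply (cone_lim HX (F := Riemann_fine a b) _ _ Hv).
exists (mkposreal 1 Rlt_0_1). intros ptd _ [Hp _].
apply (cone_scal HX); [|now apply Riemann_sum_cone].
destruct Hab as [Hab| ->].
- rewrite sign_eq_1; lra.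
- rewrite Rminus_diag, sign_0; lra.
Qed.

Lemma is_RInt_linear (L : X -> X) (f : R -> X) a b v :
  is_linear L -> is_RInt f a b v -> is_RInt (fun s => L (f s)) a b (L v).
Proof.
intros HL Hv. unfold is_RInt.
eapply filterlim_ext; [|exact (lim_linear (F := Riemann_fine a b) L _ _ HL Hv)].
intros ptd. transitivity (scal (sign (b - a)) (L (Riemann_sum f ptd))).
{ exact (linear_scal L HL (sign (b - a)) (Riemann_sum f ptd)). }
f_equal.
apply SF_cons_ind with (s := ptd); clear ptd.
- intros x0. change (L zero = zero).
  transitivity (L (scal 0 zero)); [f_equal; vec|].
  etransitivity; [exact (linear_scal L HL 0 zero)|]. vec.
- intros h ptd IH. rewrite !(Riemann_sum_cons (V := X)).
  etransitivity; [exact (linear_plus L HL _ _)|].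
  apply (f_equal2 plus); [exact (linear_scal L HL _ _)|exact IH].
Qed.

End ConeIntegral.

Section Semigroup.
Context {X : CompleteNormedModule R_AbsRing} {P : X -> Prop} {Psi : X -> R}
  (HX : is_abstract_state_space P) (HPsi : is_norm_functional P Psi)
  {T : R -> X -> X} (HT : is_substochastic P T).

Local Notation zero := (@Hierarchy.zero X).
Local Notation plus := (@Hierarchy.plus X).
Local Notation opp := (@Hierarchy.opp X).
Local Notation minus := (@Hierarchy.minus X).
Local Notation scal := (@Hierarchy.scal R_AbsRing X).
Local Notation norm := (@Hierarchy.norm R_AbsRing X).
Local Notation sum_n := (@Hierarchy.sum_n X).

Lemma semigroup_pm t : 0 <= t -> positive_map P 1 (T t).
Proof.
destruct HT as (H0 & Hpos & Hle). intros Ht. split.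
- apply (linear_plus _ (semigroup_bounded H0 Ht)).
- apply (linear_scal _ (semigroup_bounded H0 Ht)).
- intros u Hu; now apply Hpos.
- intros u Hu; rewrite Rmult_1_l; now apply Hle.
Qed.

Lemma semigroup_0 x : T 0 x = x.
Proof. apply (semigroup_zero (proj1 HT)). Qed.

Lemma semigroup_add s t x : 0 <= s -> 0 <= t -> T (s + t) x = T s (T t x).
Proof. intros. now apply (semigroup_plus (proj1 HT)). Qed.

Lemma semigroup_comm s t x : 0 <= s -> 0 <= t -> T s (T t x) = T t (T s x).
Proof. intros. rewrite <- !semigroup_add by auto. f_equal. ring. Qed.

Lemma semigroup_linear t : 0 <= t -> is_linear (T t).
Proof. intros Ht. apply (semigroup_bounded (proj1 HT) Ht). Qed.

Lemma at_right_lt (d : R) : 0 < d -> at_right 0 (fun h => 0 < h < d).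
Proof.
intros Hd. exists (mkposreal d Hd). intros h Hh Hpos. split; auto.
assert (H : Rabs (h - 0) < d) by exact Hh.
rewrite Rminus_0_r, Rabs_pos_eq in H; lra.
Qed.

Lemma at_right_pos : at_right 0 (fun h => 0 < h).
Proof. exists (mkposreal 1 Rlt_0_1). auto. Qed.

Lemma at_right_ex (Q : R -> Prop) : at_right 0 Q -> exists d, 0 < d /\ forall h, 0 < h < d -> Q h.
Proof.
intros [[d Hd] H]. exists d; split; auto. intros h Hh. apply H; [|lra].
change (Rabs (h - 0) < d). rewrite Rminus_0_r, Rabs_pos_eq; lra.
Qed.

(** For [a <= b], T(b) x - T(a) x is T(a) applied to T(b - a) x - x, so strong continuity at 0 and
    the common bound on the operators give a modulus that depends on [b - a] only. Continuity from
    the left comes with it. *)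
Lemma semigroup_continuous_orbit x s :
  filterlim (fun s => T (Rmax 0 s) x) (locally s) (locally (T (Rmax 0 s) x)).
Proof.
destruct (pm_norm_bound HX HPsi) as (M & HM & HB).
apply lim_norm. intros eps He.
destruct (at_right_ex _ (proj1 (lim_norm (F := at_right 0) _ _)
  (semigroup_continuous (proj1 HT) (u := x)) (eps / (M + 1)) ltac:(apply Rdiv_lt_0_compat; lra)))
  as (d & Hd & H).
assert (H' : forall a b, 0 <= a <= b -> b - a < d -> norm (minus (T b x) (T a x)) < eps).
{ intros a b Hab Hba. destruct (proj2 Hab) as [Hlt| ->].
  - replace b with (a + (b - a)) by ring. rewrite semigroup_add by lra.
    rewrite <- (pm_minus _ _ (semigroup_pm a (proj1 Hab))).
    apply Rle_lt_trans with (1 := HB 1 _ _ Rle_0_1 (semigroup_pm a (proj1 Hab))).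
    specialize (H (b - a) ltac:(lra)).
    apply Rle_lt_trans with (M * (eps / (M + 1))).
    + rewrite Rmult_1_r. apply Rmult_le_compat_l; lra.
    + apply Rlt_le_trans with ((M + 1) * (eps / (M + 1))).
      * apply Rmult_lt_compat_r; [apply Rdiv_lt_0_compat|]; lra.
      * right; field; lra.
  - now rewrite norm_minus_self. }
exists (mkposreal d Hd). intros s' Hs'.
assert (Hs : Rabs (s' - s) < d) by exact Hs'.
apply Rabs_def2 in Hs.
destruct (Rle_dec (Rmax 0 s) (Rmax 0 s')) as [Hle|Hle].
- apply H'; [split; auto; apply Rmax_l|].
  revert Hle; unfold Rmax; repeat destruct Rle_dec; lra.
- rewrite norm_minus_sym. apply H'; [split; [apply Rmax_l|lra]|].
  revert Hle; unfold Rmax; repeat destruct Rle_dec; lra.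
Qed.

(** [exp (- l s) T(s) x], frozen for [s < 0] so as to be continuous everywhere. *)
Definition orbit (l : R) (x : X) (s : R) : X :=
  scal (exp (- (l * Rmax 0 s))) (T (Rmax 0 s) x).

Lemma orbit_pos l x s : P x -> P (orbit l x s).
Proof.
intros Hx. apply (cone_scal HX); [left; apply exp_pos|].
apply (pm_pos _ _ _ (semigroup_pm _ (Rmax_l 0 s))); auto.
Qed.

Lemma Rmax_0_continuous s : continuous (fun s => Rmax 0 s) s.
Proof.
intros Q [[eps He] H]. exists (mkposreal eps He). intros s' Hs'. apply H.
assert (h : Rabs (s' - s) < eps) by exact Hs'.
change (Rabs (Rmax 0 s' - Rmax 0 s) < eps).
revert h. unfold Rmax; repeat destruct Rle_dec; unfold Rabs; repeat destruct Rcase_abs; lra.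
Qed.

Lemma orbit_continuous l x s : continuous (orbit l x) s.
Proof.
apply (continuous_scal (fun s => exp (- (l * Rmax 0 s))) (fun s => T (Rmax 0 s) x)).
- apply (continuous_comp (fun s => Rmax 0 s) (fun y => exp (- (l * y)))).
  + apply Rmax_0_continuous.
  + apply (@ex_derive_continuous R_AbsRing R_NormedModule). auto_derive. auto.
- apply semigroup_continuous_orbit.
Qed.

Definition orbit_integral (l t : R) (x : X) : X := RInt (orbit l x) 0 t.

Lemma orbit_integral_correct l x a b : is_RInt (orbit l x) a b (RInt (orbit l x) a b).
Proof.
apply (RInt_correct (V := X)), ex_RInt_continuous. intros; apply orbit_continuous.
Qed.

Lemma orbit_integral_is l t x : is_RInt (orbit l x) 0 t (orbit_integral l t x).
Proof. apply orbit_integral_correct. Qed.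

Lemma orbit_integral_RInt t x : 0 <= t ->
  RInt (fun s => T s x) 0 t = orbit_integral 0 t x.
Proof.
intros Ht. apply RInt_ext. intros s. rewrite Rmin_left, Rmax_right by auto.
intros Hs. unfold orbit. rewrite Rmax_right by lra.
rewrite Rmult_0_l, Ropp_0, exp_0. vec.
Qed.

Lemma orbit_integral_unique l t x v : is_RInt (orbit l x) 0 t v -> orbit_integral l t x = v.
Proof. apply (is_RInt_unique (V := X)). Qed.

Lemma orbit_integral_pm l t : 0 <= l -> 0 <= t -> positive_map P t (orbit_integral l t).
Proof.
intros Hl Ht; split.
- intros x y. apply orbit_integral_unique.
  eapply is_RInt_ext; [|exact (is_RInt_plus (V := X) _ _ _ _ _ _ (orbit_integral_is l t x) (orbit_integral_is l t y))].
  intros s _. unfold orbit. rewrite (pm_plus _ _ _ (semigroup_pm _ (Rmax_l 0 s))). vec.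
- intros r x. apply orbit_integral_unique.
  eapply is_RInt_ext; [|exact (is_RInt_scal (V := X) _ _ _ r _ (orbit_integral_is l t x))].
  intros s _. unfold orbit. rewrite (pm_scal _ _ _ (semigroup_pm _ (Rmax_l 0 s))). vec.
- intros u Hu. apply (is_RInt_cone HX (orbit l u) 0 t); auto.
  + intros s _; now apply orbit_pos.
  + apply orbit_integral_is.
- intros u Hu.
  replace (t * norm u) with ((t - 0) * norm u) by ring.
  apply (norm_RInt_le_const (V := X) (orbit l u) 0 t); auto; [|apply orbit_integral_is].
  intros s Hs. unfold orbit. rewrite (cone_norm_scal HX HPsi).
  + apply Rle_trans with (1 * norm (T (Rmax 0 s) u)).
    * apply Rmult_le_compat_r; [apply norm_ge_0|].
      rewrite <- exp_0. 
      destruct (Rle_lt_or_eq_dec 0 (l * Rmax 0 s)) as [h|h].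
      { apply Rmult_le_pos; auto. apply Rmax_l. }
      { left. apply exp_increasing. lra. }
      { rewrite <- h, Ropp_0. apply Rle_refl. }
    * rewrite Rmult_1_l. rewrite <- (Rmult_1_l (norm u)).
      now apply (pm_bound _ _ _ (semigroup_pm _ (Rmax_l 0 s))).
  + left; apply exp_pos.
  + now apply (pm_pos _ _ _ (semigroup_pm _ (Rmax_l 0 s))).
Qed.

Lemma orbit_integral_linear l t : 0 <= l -> 0 <= t -> is_linear (orbit_integral l t).
Proof. intros Hl Ht. apply (pm_linear HX HPsi t); auto. now apply orbit_integral_pm. Qed.

Lemma orbit_integral_comm l t h x : 0 <= t -> 0 <= h ->
  T h (orbit_integral l t x) = orbit_integral l t (T h x).
Proof.
intros Ht Hh. symmetry. apply orbit_integral_unique.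
eapply is_RInt_ext; [|exact (is_RInt_linear (T h) _ _ _ _ (semigroup_linear h Hh) (orbit_integral_is l t x))].
intros s _. unfold orbit. rewrite (pm_scal _ _ _ (semigroup_pm h Hh)).
now rewrite (semigroup_comm h) by (auto; apply Rmax_l).
Qed.

Lemma orbit_integral_add l t h x : 0 <= t -> 0 <= h ->
  orbit_integral l (t + h) x =
  plus (orbit_integral l t x) (scal (exp (- (l * t))) (T t (orbit_integral l h x))).
Proof.
intros Ht Hh. apply orbit_integral_unique.
apply (is_RInt_Chasles (V := X) _ 0 t (t + h) _ _ (orbit_integral_is l t x)).
set (v := scal (exp (- (l * t))) (T t (orbit_integral l h x))).
(* The piece over [t, t + h] is a translate of the integral over [0, h]. The shape [1 * s + t] is
   the affine form expected by [is_RInt_comp_lin]. *)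
assert (H : is_RInt (fun s => orbit l x (1 * s + t)) 0 h v).
{ eapply is_RInt_ext; [|exact (is_RInt_scal (V := X) _ _ _ (exp (- (l * t))) _
    (is_RInt_linear (T t) _ _ _ _ (semigroup_linear t Ht) (orbit_integral_is l h x)))].
  intros s. rewrite Rmin_left, Rmax_right by auto. intros Hs.
  unfold orbit. rewrite !Rmax_right by lra.
  rewrite (pm_scal _ _ _ (semigroup_pm t Ht)), <- semigroup_add by lra.
  replace (1 * s + t) with (t + s) by ring.
  transitivity (scal (exp (- (l * t)) * exp (- (l * s))) (T (t + s) x)); [vec|].
  rewrite <- exp_plus. f_equal. f_equal. ring. }
assert (E := orbit_integral_correct l x t (t + h)).
assert (E' : is_RInt (orbit l x) (1 * 0 + t) (1 * h + t) (RInt (orbit l x) t (t + h))).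
{ replace (1 * 0 + t) with t by ring. replace (1 * h + t) with (t + h) by ring. exact E. }
apply (is_RInt_comp_lin (V := X)) in E'.
assert (E2 : v = RInt (orbit l x) t (t + h)).
{ apply (is_RInt_unique (V := X)) in H. apply (is_RInt_unique (V := X)) in E'.
  rewrite <- H, <- E'. apply RInt_ext. intros s _. vec. }
rewrite E2. exact E.
Qed.

Lemma orbit_integral_at_0 l x :
  filterlim (fun h => scal (/ h) (orbit_integral l h x)) (at_right 0) (locally x).
Proof.
apply lim_norm. intros eps He.
assert (Hc := orbit_continuous l x 0).
assert (E0 : orbit l x 0 = x).
{ unfold orbit. rewrite Rmax_left by lra. rewrite Rmult_0_r, Ropp_0, exp_0, semigroup_0. vec. }
unfold continuous in Hc. rewrite E0 in Hc.
destruct (proj1 (lim_norm (F := locally 0) _ _) Hc (eps / 2) ltac:(lra)) as ([d Hd] & H).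
generalize (at_right_lt d Hd). apply filter_imp. intros h Hh.
apply Rle_lt_trans with (eps / 2); [|lra].
replace (minus (scal (/ h) (orbit_integral l h x)) x) with
  (scal (/ h) (minus (orbit_integral l h x) (scal h x))) by (vec; lra).
eapply Rle_trans; [apply norm_scal_le|].
assert (Hh' : 0 < / h) by (apply Rinv_0_lt_compat; lra).
rewrite Rabs_pos_eq by lra.
apply Rle_trans with (/ h * ((h - 0) * (eps / 2))); [|right; field; lra].
apply Rmult_le_compat_l; [lra|].
apply (norm_RInt_le_const (V := X) (fun s => minus (orbit l x s) x) 0 h); [lra| |].
- intros s Hs. left. apply (H s). change (Rabs (s - 0) < d).
  rewrite Rminus_0_r, Rabs_pos_eq; lra.
- apply (is_RInt_minus (V := X)); [apply orbit_integral_is|].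
  replace (scal h x) with (scal (h - 0) x) by (rewrite Rminus_0_r; reflexivity).
  apply (is_RInt_const (V := X)).
Qed.

End Semigroup.

Arguments orbit {X} T l x s.
Arguments orbit_integral {X} T l t x.

(** * Generators and resolvents *)

Lemma exp_at_right l : filterlim (fun h => exp (l * h)) (at_right 0) (locally 1).
Proof.
assert (H : continuous (fun h => exp (l * h)) 0).
{ apply (@ex_derive_continuous R_AbsRing R_NormedModule). auto_derive. auto. }
unfold continuous in H. rewrite Rmult_0_r, exp_0 in H.
apply filterlim_filter_le_1 with (2 := H). apply filter_le_within.
Qed.

Lemma exp_quotient_at_right l :
  filterlim (fun h => / h * (exp (l * h) - 1)) (at_right 0) (locally l).
Proof.
assert (H : is_derive (fun h => exp (l * h)) 0 l).
{ auto_derive; auto. rewrite Rmult_0_r, exp_0. ring. }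
apply is_derive_Reals in H.
intros Q [[eps He] HQ]. destruct (H eps He) as [d Hd].
generalize (at_right_lt d (cond_pos d)). unfold filtermap. apply filter_imp.
intros h Hh. apply HQ. change (Rabs (/ h * (exp (l * h) - 1) - l) < eps).
specialize (Hd h ltac:(lra)). rewrite Rplus_0_l, Rmult_0_r, exp_0 in Hd.
rewrite Rmult_comm. apply Hd. rewrite Rabs_pos_eq; lra.
Qed.

Section Generator.
Context {X : CompleteNormedModule R_AbsRing} {P : X -> Prop} {Psi : X -> R}
  (HX : is_abstract_state_space P) (HPsi : is_norm_functional P Psi)
  {T : R -> X -> X} (HT : is_substochastic P T).

Local Notation zero := (@Hierarchy.zero X).
Local Notation plus := (@Hierarchy.plus X).
Local Notation opp := (@Hierarchy.opp X).
Local Notation minus := (@Hierarchy.minus X).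
Local Notation scal := (@Hierarchy.scal R_AbsRing X).
Local Notation norm := (@Hierarchy.norm R_AbsRing X).
Local Notation sum_n := (@Hierarchy.sum_n X).

Lemma lim_scal_fun {A} {F : (A -> Prop) -> Prop} {FF : ProperFilter F}
    (c : A -> R) (f : A -> X) (r : R) x :
  filterlim c F (locally r) -> filterlim f F (locally x) ->
  filterlim (fun a => scal (c a) (f a)) F (locally (scal r x)).
Proof.
intros Hc Hf.
exact (@filterlim_comp_2 A R X X F _ _ _ _ c f scal Hc Hf (filterlim_scal r x)).
Qed.

Lemma generator_at_unique w v v' :
  is_generator_at T w v -> is_generator_at T w v' -> v = v'.
Proof. apply (lim_unique (F := at_right 0)). Qed.

Lemma generator_op w v : is_generator_at T w v -> generator T w = v.
Proof.
intros H. apply (iota_unique (is_generator_at T w) v); auto.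
intros y Hy. now apply (generator_at_unique w).
Qed.

Lemma generator_dom w : dom (generator T) w -> is_generator_at T w (generator T w).
Proof. intros [v Hv]. now rewrite (generator_op w v Hv). Qed.

Lemma generator_at_ext (f : R -> X) w v :
  (forall h, 0 < h -> scal (/ h) (minus (T h w) w) = f h) ->
  filterlim f (at_right 0) (locally v) -> is_generator_at T w v.
Proof.
intros H. apply filterlim_ext_loc.
generalize at_right_pos. apply filter_imp. intros h Hh. symmetry; auto.
Qed.

Lemma generator_at_plus w w' v v' :
  is_generator_at T w v -> is_generator_at T w' v' ->
  is_generator_at T (plus w w') (plus v v').
Proof.
intros H H'. eapply generator_at_ext; [|exact (lim_plus (F := at_right 0) _ _ _ _ H H')].
intros h Hh; simpl. rewrite (pm_plus _ _ _ (semigroup_pm HT h (Rlt_le _ _ Hh))). vec.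
Qed.

Lemma generator_at_scal (r : R) w v :
  is_generator_at T w v -> is_generator_at T (scal r w) (scal r v).
Proof.
intros H. eapply generator_at_ext; [|exact (lim_scal (F := at_right 0) r _ _ H)].
intros h Hh; simpl. rewrite (pm_scal _ _ _ (semigroup_pm HT h (Rlt_le _ _ Hh))). vec.
Qed.

Lemma generator_at_minus w w' v v' :
  is_generator_at T w v -> is_generator_at T w' v' ->
  is_generator_at T (minus w w') (minus v v').
Proof.
intros H H'. replace (minus w w') with (plus w (scal (-1) w')) by vec.
replace (minus v v') with (plus v (scal (-1) v')) by vec.
apply generator_at_plus; auto. now apply generator_at_scal.
Qed.

(** On the cone [Psi] is the norm, so [Psi] of the difference quotient is a quotient of norms, which
    [T] does not increase. *)
Lemma generator_at_dissipative w v : P w -> is_generator_at T w v -> Psi v <= 0.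
Proof.
intros Pw H.
apply (filterlim_le (F := at_right 0)
  (fun h => Psi (scal (/ h) (minus (T h w) w))) (fun _ => 0) (Psi v) 0).
- generalize at_right_pos. apply filter_imp. intros h Hh.
  assert (Hp := semigroup_pm HT h (Rlt_le _ _ Hh)).
  rewrite (Psi_scal HPsi), (Psi_minus HPsi), !(Psi_norm HPsi); auto.
  + generalize (pm_bound _ _ _ Hp w Pw) (Rinv_0_lt_compat h Hh). nra.
  + now apply (pm_pos _ _ _ Hp).
- exact (lim_linear (F := at_right 0) (Psi : X -> R_NormedModule) _ _ (Psi_linear HPsi) H).
- apply filterlim_const.
Qed.

(* Both ways of writing the integral over [0, t + h]. *)
Lemma orbit_integral_shift l t h x : 0 <= t -> 0 <= h ->
  T h (orbit_integral T l t x) =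
  scal (exp (l * h)) (plus (orbit_integral T l t x)
    (minus (scal (exp (- (l * t))) (T t (orbit_integral T l h x))) (orbit_integral T l h x))).
Proof.
intros Ht Hh.
assert (E1 := orbit_integral_add HX HPsi HT l t h x Ht Hh).
assert (E2 := orbit_integral_add HX HPsi HT l h t x Hh Ht).
rewrite Rplus_comm, E1 in E2.
transitivity (scal (exp (l * h)) (scal (exp (- (l * h))) (T h (orbit_integral T l t x)))).
{ transitivity (scal (exp (l * h) * exp (- (l * h))) (T h (orbit_integral T l t x))); [|vec].
  rewrite <- exp_plus, Rplus_opp_r, exp_0. vec. }
f_equal.
transitivity (minus (plus (orbit_integral T l h x)
  (scal (exp (- (l * h))) (T h (orbit_integral T l t x)))) (orbit_integral T l h x)); [vec|].
rewrite <- E2. vec.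
Qed.

Lemma generator_at_orbit_integral l t x : 0 <= t ->
  is_generator_at T (orbit_integral T l t x)
    (plus (scal l (orbit_integral T l t x)) (minus (scal (exp (- (l * t))) (T t x)) x)).
Proof.
intros Ht.
apply generator_at_ext with (fun h =>
  plus (scal (/ h * (exp (l * h) - 1)) (orbit_integral T l t x))
   (scal (exp (l * h)) (minus
      (scal (exp (- (l * t))) (T t (scal (/ h) (orbit_integral T l h x))))
      (scal (/ h) (orbit_integral T l h x))))).
{ intros h Hh. rewrite orbit_integral_shift by lra.
  rewrite (pm_scal _ _ _ (semigroup_pm HT t Ht)). vec. }
apply (lim_plus (F := at_right 0)).
- apply (lim_scal_fun (F := at_right 0)); [apply exp_quotient_at_right|apply filterlim_const].
- replace (minus (scal (exp (- (l * t))) (T t x)) x) with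
    (scal 1 (minus (scal (exp (- (l * t))) (T t x)) x)) by vec.
  assert (H0 := orbit_integral_at_0 HX HPsi HT l x).
  apply (lim_scal_fun (F := at_right 0)); [apply exp_at_right|].
  apply (lim_minus (F := at_right 0)); auto.
  apply (lim_scal (F := at_right 0)).
  apply (lim_linear (F := at_right 0) (T t)); auto. now apply (semigroup_linear HT).
Qed.

(** The truncated Laplace transform commutes with every [T h], so the generator at its value on [w]
    is its value on [v]; [generator_at_orbit_integral] computes the same vector in a second way. *)
Lemma orbit_integral_generator_at l t w v : 0 <= l -> 0 <= t -> is_generator_at T w v ->
  orbit_integral T l t (minus (scal l w) v) = minus w (scal (exp (- (l * t))) (T t w)).
Proof.
intros Hl Ht H. assert (HE := orbit_integral_pm HX HPsi HT l t Hl Ht).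
assert (H1 : is_generator_at T (orbit_integral T l t w) (orbit_integral T l t v)).
{ eapply generator_at_ext; [|exact (lim_linear (F := at_right 0) (orbit_integral T l t) _ _
    (orbit_integral_linear HX HPsi HT l t Hl Ht) H)].
  intros h Hh; simpl. rewrite (pm_scal _ _ _ HE), (pm_minus _ _ HE).
  now rewrite (orbit_integral_comm HX HPsi HT) by lra. }
assert (H2 := generator_at_unique _ _ _ H1 (generator_at_orbit_integral l t w Ht)).
rewrite (pm_minus _ _ HE), (pm_scal _ _ _ HE), H2. vec.
Qed.

Lemma exp_INR l n : exp (- (l * INR n)) = exp (- l) ^ n.
Proof.
induction n as [|n IH].
- simpl. now rewrite Rmult_0_r, Ropp_0, exp_0.
- rewrite S_INR. simpl. rewrite <- IH, <- exp_plus. f_equal. ring.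
Qed.

Lemma exp_INR_lim l : 0 < l -> is_lim_seq (fun n => exp (- (l * INR n))) 0.
Proof.
intros Hl. apply is_lim_seq_ext with (fun n => exp (- l) ^ n).
{ intros n; now rewrite exp_INR. }
apply is_lim_seq_geom. rewrite Rabs_pos_eq by (left; apply exp_pos).
rewrite <- exp_0. apply exp_increasing. lra.
Qed.

Lemma exp_orbit_lim l (x : X) : 0 < l ->
  filterlim (fun n => scal (exp (- (l * INR n))) (T (INR n) x)) eventually (locally zero).
Proof.
intros Hl. destruct (pm_norm_bound HX HPsi) as (M & HM & HB).
apply (lim_squeeze (F := eventually)) with (fun n => M * 1 * norm x * exp (- (l * INR n))).
- apply filter_forall. intros n.
  replace (minus (scal (exp (- (l * INR n))) (T (INR n) x)) zero)
    with (scal (exp (- (l * INR n))) (T (INR n) x)) by vec.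
  eapply Rle_trans; [apply norm_scal_le|].
  rewrite Rabs_pos_eq by (left; apply exp_pos). rewrite Rmult_comm.
  apply Rmult_le_compat_r; [left; apply exp_pos|].
  apply HB; [apply Rle_0_1|]. apply (semigroup_pm HT), pos_INR.
- generalize (is_lim_seq_scal_l _ (M * 1 * norm x) _ (exp_INR_lim l Hl)).
  simpl Rbar_mult. rewrite Rmult_0_r. auto.
Qed.

(** The improper integral of exp(- l s) T(s) x over the half-line. The limit is taken along
    integers, where the increments are dominated by a geometric sequence. *)
Definition laplace (l : R) (x : X) : X :=
  iota (fun y => filterlim (fun n => orbit_integral T l (INR n) x) eventually (locally y)).

Lemma laplace_lim l x : 0 < l ->
  filterlim (fun n => orbit_integral T l (INR n) x) eventually (locally (laplace l x)).
Proof.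
intros Hl. apply (iota_correct (fun y =>
  filterlim (fun n => orbit_integral T l (INR n) x) eventually (locally y))).
destruct (pm_norm_bound HX HPsi) as (M & HM & HB).
destruct (seq_complete (fun n => orbit_integral T l (INR n) x)
  (fun n => M * 1 * norm (orbit_integral T l 1 x) * exp (- l) ^ n)) as [y Hy].
- intros n. rewrite <- exp_INR, S_INR, (orbit_integral_add HX HPsi HT), minus_plus_l
    by (try apply pos_INR; lra).
  eapply Rle_trans; [apply norm_scal_le|].
  rewrite Rabs_pos_eq by (left; apply exp_pos). rewrite Rmult_comm.
  apply Rmult_le_compat_r; [left; apply exp_pos|].
  apply HB; [apply Rle_0_1|]. apply (semigroup_pm HT), pos_INR.
- apply ex_series_geom_scal. split; [left; apply exp_pos|].
  rewrite <- exp_0. apply exp_increasing. lra.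
- exists y. split; auto. intros y' Hy'. now apply (lim_unique (F := eventually) _ _ _ Hy).
Qed.

Lemma generator_at_laplace l x : 0 < l ->
  is_generator_at T (laplace l x) (minus (scal l (laplace l x)) x).
Proof.
intros Hl.
assert (E : forall h, 0 < h -> T h (laplace l x) =
  scal (exp (l * h)) (minus (laplace l x) (orbit_integral T l h x))).
{ intros h Hh. apply (lim_unique (F := eventually) (fun n => T h (orbit_integral T l (INR n) x))).
  - apply (lim_linear (F := eventually) (T h)); [apply (semigroup_linear HT); lra|].
    now apply laplace_lim.
  - eapply filterlim_ext.
    { intros n; symmetry; apply orbit_integral_shift; [apply pos_INR|lra]. }
    apply (lim_scal (F := eventually)).
    replace (minus (laplace l x) (orbit_integral T l h x)) with
      (plus (laplace l x) (minus zero (orbit_integral T l h x))) by vec.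
    apply (lim_plus (F := eventually)); [now apply laplace_lim|].
    apply (lim_minus (F := eventually)); [now apply exp_orbit_lim|apply filterlim_const]. }
apply generator_at_ext with (fun h =>
  minus (scal (/ h * (exp (l * h) - 1)) (laplace l x))
   (scal (exp (l * h)) (scal (/ h) (orbit_integral T l h x)))).
{ intros h Hh. rewrite E by auto. vec. }
apply (lim_minus (F := at_right 0)).
- apply (lim_scal_fun (F := at_right 0)); [apply exp_quotient_at_right|apply filterlim_const].
- assert (H1 := lim_scal_fun (F := at_right 0) _ _ 1 x (exp_at_right l)
    (orbit_integral_at_0 HX HPsi HT l x)).
  replace (scal 1 x) with x in H1 by vec. exact H1.
Qed.

Lemma laplace_generator_at l w v : 0 < l -> is_generator_at T w v ->
  laplace l (minus (scal l w) v) = w.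
Proof.
intros Hl H.
apply (lim_unique (F := eventually) (fun n => orbit_integral T l (INR n) (minus (scal l w) v))).
- now apply laplace_lim.
- eapply filterlim_ext.
  { intros n; symmetry; apply orbit_integral_generator_at; auto; [lra|apply pos_INR]. }
  assert (H1 := lim_minus (F := eventually) _ _ _ _ (filterlim_const w) (exp_orbit_lim l w Hl)).
  replace (minus w zero) with w in H1 by vec. exact H1.
Qed.

Lemma resolvent_generator l x : 0 < l -> resolvent (generator T) l x = laplace l x.
Proof.
intros Hl. assert (H := generator_at_laplace l x Hl).
apply (iota_unique (fun w => dom (generator T) w /\ minus (scal l w) (generator T w) = x)).
- intros y [Hy Ey]. apply generator_dom in Hy.
  rewrite <- Ey. symmetry. now apply laplace_generator_at.
- split; [now eexists; exact H|]. rewrite (generator_op _ _ H). vec.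
Qed.

(** The bound [/ l] cannot come from the truncated integrals, whose bounds [INR n] blow up. It comes
    from dissipativity: [Psi] is nonpositive at the generator value [l w - u] of the transform [w]
    of [u]. *)
Lemma laplace_pm l : 0 < l -> positive_map P (/ l) (laplace l).
Proof.
intros Hl.
assert (HE : forall n, positive_map P (INR n) (orbit_integral T l (INR n))).
{ intros n. apply (orbit_integral_pm HX HPsi HT); [lra|apply pos_INR]. }
assert (Hpos : forall u, P u -> P (laplace l u)).
{ intros u Hu. apply (cone_lim HX (F := eventually) _ _ (laplace_lim l u Hl)).
  apply filter_forall. intros n. now apply (pm_pos _ _ _ (HE n)). }
split; auto.
- intros x y.
  apply (lim_unique (F := eventually) (fun n => orbit_integral T l (INR n) (plus x y))).
  + now apply laplace_lim.
  + eapply filterlim_ext; [intros n; symmetry; apply (pm_plus _ _ _ (HE n))|].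
    now apply (lim_plus (F := eventually)); apply laplace_lim.
- intros r x.
  apply (lim_unique (F := eventually) (fun n => orbit_integral T l (INR n) (scal r x))).
  + now apply laplace_lim.
  + eapply filterlim_ext; [intros n; symmetry; apply (pm_scal _ _ _ (HE n))|].
    now apply (lim_scal (F := eventually)); apply laplace_lim.
- intros u Hu.
  generalize (generator_at_dissipative _ _ (Hpos u Hu) (generator_at_laplace l u Hl)).
  rewrite (Psi_minus HPsi), (Psi_scal HPsi), !(Psi_norm HPsi); auto. intros H.
  apply Rmult_le_reg_l with l; auto. rewrite <- Rmult_assoc, Rinv_r by lra. lra.
Qed.

Lemma laplace_identity l m x : 0 < l -> 0 < m ->
  laplace m x = laplace l (plus x (scal (l - m) (laplace m x))).
Proof.
intros Hl Hm.
rewrite <- (laplace_generator_at l _ _ Hl (generator_at_laplace m x Hm)) at 1.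
f_equal. vec.
Qed.

Lemma laplace_generator_comm l w v : 0 < l -> is_generator_at T w v ->
  laplace l v = minus (scal l (laplace l w)) w.
Proof.
intros Hl H. assert (HL := laplace_pm l Hl).
rewrite <- (laplace_generator_at l w v Hl H) at 2.
rewrite (pm_minus _ _ HL), (pm_scal _ _ _ HL). vec.
Qed.

Lemma orbit_integral_laplace l t x : 0 < l -> 0 <= t ->
  orbit_integral T l t x = minus (laplace l x) (scal (exp (- (l * t))) (laplace l (T t x))).
Proof.
intros Hl Ht. assert (HL := laplace_pm l Hl).
rewrite <- (laplace_generator_at l _ _ Hl (generator_at_orbit_integral l t x Ht)).
rewrite <- (pm_scal _ _ _ HL), <- (pm_minus _ _ HL). f_equal. vec.
Qed.

Lemma generator_domain_dense : dense (fun w : X => exists v, is_generator_at T w v).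
Proof.
intros x eps He.
destruct (filter_ex (F := at_right 0) _ (filter_and _ _ at_right_pos
  (proj1 (lim_norm (F := at_right 0) _ _) (orbit_integral_at_0 HX HPsi HT 0 x) eps He)))
  as (h & Hh & H).
exists (scal (/ h) (orbit_integral T 0 h x)). split.
- eexists. apply generator_at_scal, generator_at_orbit_integral. lra.
- now rewrite norm_minus_sym.
Qed.

(** On the domain of the generator the error is the resolvent applied to the generator value, hence
    of order 1 / m; density and the common bound do the rest. [INR (S n)] keeps the parameter
    positive. *)
Lemma laplace_large x :
  filterlim (fun n => scal (INR (S n)) (laplace (INR (S n)) x)) eventually (locally x).
Proof.
assert (Hn : forall n, 0 < INR (S n)) by (intros; apply lt_0_INR; lia).
apply (pm_lim_dense HX HPsi (F := eventually) 1
  (fun n x => scal (INR (S n)) (laplace (INR (S n)) x)) (fun x => x)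
  (fun w => exists v, is_generator_at T w v)); try lra.
- apply filter_forall. intros n. rewrite <- (Rinv_r (INR (S n))) by (generalize (Hn n); lra).
  apply (pm_scale HX HPsi); [left; auto|]. now apply laplace_pm.
- apply pm_id.
- apply generator_domain_dense.
- intros w [v Hv]. destruct (pm_norm_bound HX HPsi) as (M & HM & HB).
  apply (lim_squeeze (F := eventually)) with (fun n => M * norm v * / INR (S n)).
  + apply filter_forall. intros n.
    rewrite <- (laplace_generator_comm (INR (S n)) w v) by auto.
    replace (M * norm v * / INR (S n)) with (M * / INR (S n) * norm v) by ring.
    apply HB; [left; apply Rinv_0_lt_compat; auto|]. now apply laplace_pm.
  + assert (H : is_lim_seq (fun n => M * norm v * / INR (S n)) (M * norm v * 0)).
    { apply (is_lim_seq_scal_l _ (M * norm v) 0).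
      apply (is_lim_seq_incr_1 (fun n => / INR n)).
      apply (is_lim_seq_inv INR p_infty); [apply is_lim_seq_INR|easy]. }
    rewrite Rmult_0_r in H. exact H.
Qed.

End Generator.

Arguments laplace {X} T l x.

(** Used in two ways: with [c = exp (l * t)] and [m = 0], to dominate the plain integral by the
    weighted one, and with [c = 1] and [l = 0], for the converse. *)
Lemma orbit_integral_compare {X : CompleteNormedModule R_AbsRing} {P : X -> Prop} {Psi : X -> R}
    (HX : is_abstract_state_space P) (HPsi : is_norm_functional P Psi)
    (T : R -> X -> X) (HT : is_substochastic P T) (c l m t : R) u :
  0 <= t -> P u -> (forall s, 0 <= s <= t -> exp (- (m * s)) <= c * exp (- (l * s))) ->
  P (minus (scal c (orbit_integral T l t u)) (orbit_integral T m t u)).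
Proof.
intros Ht Hu H.
apply (is_RInt_cone HX (fun s => minus (scal c (orbit T l u s)) (orbit T m u s)) 0 t); auto.
- intros s Hs. unfold orbit. rewrite Rmax_right by lra.
  replace (minus _ _) with (scal (c * exp (- (l * s)) - exp (- (m * s))) (T s u)) by vec.
  apply (cone_scal HX).
  + generalize (H s Hs). lra.
  + now apply (pm_pos _ _ _ (semigroup_pm HT s (proj1 Hs))).
- apply (is_RInt_minus (V := X)); [apply (is_RInt_scal (V := X))|];
    now apply (orbit_integral_is HX HPsi).
Qed.

Lemma laplace_mono {X : CompleteNormedModule R_AbsRing} {P : X -> Prop} {Psi : X -> R}
    (HX : is_abstract_state_space P) (HPsi : is_norm_functional P Psi)
    (V W : R -> X -> X) (HV : is_substochastic P V) (HW : is_substochastic P W) l u :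
  0 < l -> P u -> (forall t, 0 <= t -> P (minus (W t u) (V t u))) ->
  P (minus (laplace W l u) (laplace V l u)).
Proof.
intros Hl Hu H.
apply (cone_lim HX (F := eventually) (fun n =>
  minus (orbit_integral W l (INR n) u) (orbit_integral V l (INR n) u))).
- apply (lim_minus (F := eventually)); now apply (laplace_lim HX HPsi).
- apply filter_forall. intros n.
  apply (is_RInt_cone HX (fun s => minus (orbit W l u s) (orbit V l u s)) 0 (INR n)).
  + apply pos_INR.
  + intros s _. unfold orbit.
    replace (minus _ _) with (scal (exp (- (l * Rmax 0 s)))
      (minus (W (Rmax 0 s) u) (V (Rmax 0 s) u))) by vec.
    apply (cone_scal HX); [left; apply exp_pos|]. apply H, Rmax_l.
  + apply (is_RInt_minus (V := X)); now apply (orbit_integral_is HX HPsi).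
Qed.

(** * The perturbation series *)

Lemma cone_norm_mono {X : CompleteNormedModule R_AbsRing} {P : X -> Prop} {Psi : X -> R}
    (HX : is_abstract_state_space P) (HPsi : is_norm_functional P Psi) x y :
  P x -> P (minus y x) -> norm x <= norm y.
Proof.
intros Hx Hyx. assert (Hy : P y).
{ replace y with (plus x (minus y x)) by vec. now apply (cone_plus HX). }
rewrite <- !(Psi_norm HPsi) by auto.
generalize (Psi_nonneg HPsi _ Hyx). rewrite (Psi_minus HPsi). lra.
Qed.

Section Perturbation.
Context {X : CompleteNormedModule R_AbsRing} {P : X -> Prop} {Psi : X -> R}
  (HX : is_abstract_state_space P) (HPsi : is_norm_functional P Psi)
  {U : R -> X -> X} (HU : is_substochastic P U) {B : operator X}
  (HBdom : forall w, dom B w <-> dom (generator U) w)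
  (HBlin : is_linear_operator B)
  (HBpos : positive_operator P B)
  (HAB : forall w, dom (generator U) w -> P w ->
           (Psi (plus (generator U w) (B w)) <= 0)%R).

Local Notation zero := (@Hierarchy.zero X).
Local Notation plus := (@Hierarchy.plus X).
Local Notation opp := (@Hierarchy.opp X).
Local Notation minus := (@Hierarchy.minus X).
Local Notation scal := (@Hierarchy.scal R_AbsRing X).
Local Notation norm := (@Hierarchy.norm R_AbsRing X).
Local Notation sum_n := (@Hierarchy.sum_n X).

Lemma dom_generator_at w v : is_generator_at U w v -> dom B w.
Proof. intros H. apply HBdom. now exists v. Qed.

Lemma dom_laplace l x : 0 < l -> dom B (laplace U l x).
Proof. intros Hl. eapply dom_generator_at. now apply (generator_at_laplace HX HPsi HU). Qed.

Lemma op_minus w w' : dom B w -> dom B w' ->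
  dom B (minus w w') /\ B (minus w w') = minus (B w) (B w').
Proof.
intros Hw Hw'. replace (minus w w') with (plus w (scal (-1) w')) by vec.
assert (H : dom B (scal (-1) w')) by now apply (dom_scal HBlin).
split; [now apply (dom_plus HBlin)|].
rewrite (op_plus HBlin), (op_scal HBlin) by auto. vec.
Qed.

Lemma mass_dissipation w v : is_generator_at U w v -> P w -> Psi v + Psi (B w) <= 0.
Proof.
intros H Hw. rewrite <- (Psi_plus HPsi), <- (generator_op w v H). apply HAB; auto. now exists v.
Qed.

Definition kick (l : R) (x : X) : X := B (laplace U l x).

(** Dissipation at w = (l - A)^-1 u, where A w = l w - u. This is the source of all bounds on the
    series: it makes [kick] a cone contraction and telescopes along its iterates. *)
Lemma kick_mass l u : 0 < l -> P u ->
  norm (kick l u) + l * norm (laplace U l u) <= norm u.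
Proof.
intros Hl Hu. assert (HR := laplace_pm HX HPsi HU l Hl).
assert (H := mass_dissipation _ _ (generator_at_laplace HX HPsi HU l u Hl) (pm_pos _ _ _ HR u Hu)).
rewrite (Psi_minus HPsi), (Psi_scal HPsi), !(Psi_norm HPsi) in H; auto.
- fold (kick l u) in H. lra.
- apply HBpos; [now apply dom_laplace|]. now apply (pm_pos _ _ _ HR).
- now apply (pm_pos _ _ _ HR).
Qed.

Lemma kick_pm l : 0 < l -> positive_map P 1 (kick l).
Proof.
intros Hl. assert (HR := laplace_pm HX HPsi HU l Hl). unfold kick. split.
- intros x y. rewrite (pm_plus _ _ _ HR). now apply (op_plus HBlin); apply dom_laplace.
- intros r x. rewrite (pm_scal _ _ _ HR). now apply (op_scal HBlin), dom_laplace.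
- intros u Hu. apply HBpos; [now apply dom_laplace|]. now apply (pm_pos _ _ _ HR).
- intros u Hu. generalize (kick_mass l u Hl Hu) (norm_ge_0 (laplace U l u)).
  unfold kick. nra.
Qed.

Definition kato_term (l : R) (n : nat) (x : X) : X := laplace U l (Nat.iter n (kick l) x).
Definition kato_sum (l : R) (n : nat) (x : X) : X := sum_n (fun k => kato_term l k x) n.

Lemma kick_iter_pm l n : 0 < l -> positive_map P 1 (Nat.iter n (kick l)).
Proof. intros Hl. apply pm_iter. now apply kick_pm. Qed.

Lemma kato_term_pm l n : 0 < l -> positive_map P (/ l) (kato_term l n).
Proof.
intros Hl. rewrite <- (Rmult_1_r (/ l)). apply (pm_comp (/ l) 1 (laplace U l)).
- left; now apply Rinv_0_lt_compat.
- now apply (laplace_pm HX HPsi HU).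
- now apply kick_iter_pm.
Qed.

Lemma kato_sum_mass l n u : 0 < l -> P u ->
  l * norm (kato_sum l n u) + norm (Nat.iter (S n) (kick l) u) <= norm u.
Proof.
intros Hl Hu. assert (HK := fun k => pm_pos _ _ _ (kick_iter_pm l k Hl) u Hu).
induction n as [|n IH].
- unfold kato_sum. rewrite sum_n_0. generalize (kick_mass l u Hl Hu).
  unfold kato_term; simpl. lra.
- unfold kato_sum in *. rewrite sum_n_S, (cone_norm_additive HX).
  + generalize (kick_mass l _ Hl (HK (S n))).
    change (kick l (Nat.iter (S n) (kick l) u)) with (Nat.iter (S (S n)) (kick l) u).
    unfold kato_term in *. lra.
  + apply (cone_sum_n HX). intros k. now apply (pm_pos _ _ _ (kato_term_pm l k Hl)).
  + now apply (pm_pos _ _ _ (kato_term_pm l (S n) Hl)).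
Qed.

Lemma kato_sum_pm l n : 0 < l -> positive_map P (/ l) (kato_sum l n).
Proof.
intros Hl. unfold kato_sum. split.
- intros x y. induction n as [|n IH].
  + rewrite !sum_n_0. apply (pm_plus _ _ _ (kato_term_pm l 0 Hl)).
  + rewrite !sum_n_S, IH, (pm_plus _ _ _ (kato_term_pm l (S n) Hl)). vec.
- intros r x. induction n as [|n IH].
  + rewrite !sum_n_0. apply (pm_scal _ _ _ (kato_term_pm l 0 Hl)).
  + rewrite !sum_n_S, IH, (pm_scal _ _ _ (kato_term_pm l (S n) Hl)). vec.
- intros u Hu. apply (cone_sum_n HX). intros k.
  now apply (pm_pos _ _ _ (kato_term_pm l k Hl)).
- intros u Hu. generalize (kato_sum_mass l n u Hl Hu) (norm_ge_0 (Nat.iter (S n) (kick l) u)).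
  intros H1 H2. apply Rmult_le_reg_l with l; auto.
  rewrite <- Rmult_assoc, Rinv_r by lra. unfold kato_sum in H1. lra.
Qed.

Definition kato (l : R) (x : X) : X :=
  iota (fun y => filterlim (fun n => kato_sum l n x) eventually (locally y)).

(** No geometric bound is at hand, since [kick] may preserve the norm. On the cone the norms of the
    terms add up to the norm of the partial sum, which [kato_sum_mass] keeps below [/ l * norm u],
    so the series converges absolutely. *)
Lemma kato_lim l x : 0 < l ->
  filterlim (fun n => kato_sum l n x) eventually (locally (kato l x)).
Proof.
intros Hl.
apply (iota_correct (fun y => filterlim (fun n => kato_sum l n x) eventually (locally y))).
assert (H : exists y, filterlim (fun n => kato_sum l n x) eventually (locally y)).
{ assert (H : forall u, P u -> exists y, filterlim (fun n => kato_sum l n u) eventually (locally y)).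
  { intros u Hu. apply (series_complete (fun k => kato_term l k u) (fun k => norm (kato_term l k u))).
    - intros; lra.
    - destruct (ex_finite_lim_seq_incr (fun n => norm (kato_sum l n u)) (/ l * norm u)) as [s Hs].
      + intros n. unfold kato_sum. rewrite sum_n_S, (cone_norm_additive HX).
        * generalize (norm_ge_0 (kato_term l (S n) u)). lra.
        * now apply (pm_pos _ _ _ (kato_sum_pm l n Hl)).
        * now apply (pm_pos _ _ _ (kato_term_pm l (S n) Hl)).
      + intros n. now apply (pm_bound _ _ _ (kato_sum_pm l n Hl)).
      + exists s. unfold is_series.
        eapply filterlim_ext; [|exact Hs]. intros n. simpl.
        induction n as [|n IH].
        * rewrite (sum_O (G := R_AbelianMonoid)). unfold kato_sum. now rewrite sum_n_0.
        * etransitivity; [|symmetry; exact (sum_Sn (G := R_AbelianMonoid) _ n)].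
          unfold kato_sum in *. rewrite sum_n_S, (cone_norm_additive HX).
          -- exact (f_equal2 Rplus IH eq_refl).
          -- now apply (pm_pos _ _ _ (kato_sum_pm l n Hl)).
          -- now apply (pm_pos _ _ _ (kato_term_pm l (S n) Hl)). }
  destruct (cone_generating HX x) as (u & v & Hu & Hv & ->).
  destruct (H u Hu) as [a Ha]. destruct (H v Hv) as [b Hb].
  exists (minus a b). eapply filterlim_ext; [|exact (lim_minus (F := eventually) _ _ _ _ Ha Hb)].
  intros n. now rewrite (pm_minus _ _ (kato_sum_pm l n Hl)). }
destruct H as [y Hy]. exists y. split; auto.
intros y' Hy'. now apply (lim_unique (F := eventually) _ _ _ Hy).
Qed.

Lemma kato_pm l : 0 < l -> positive_map P (/ l) (kato l).
Proof.
intros Hl. apply (pm_lim HX (F := eventually) (/ l) (kato_sum l)).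
- apply filter_forall. intros n. now apply kato_sum_pm.
- intros x. now apply kato_lim.
Qed.

Lemma kato_linear l : 0 < l -> is_linear (kato l).
Proof.
intros Hl. apply (pm_linear HX HPsi (/ l)).
- left; now apply Rinv_0_lt_compat.
- now apply kato_pm.
Qed.

Lemma kato_sum_kick l n x : 0 < l ->
  plus (laplace U l x) (kato_sum l n (kick l x)) = kato_sum l (S n) x.
Proof.
intros Hl. unfold kato_sum.
assert (E : forall k, kato_term l k (kick l x) = kato_term l (S k) x).
{ intros k. unfold kato_term. now rewrite Nat.iter_succ_r. }
induction n as [|n IH].
- now rewrite sum_n_S, !sum_n_0, E.
- rewrite (sum_n_S _ (S n)), <- IH, sum_n_S, E. vec.
Qed.

Lemma kato_kick l x : 0 < l -> kato l (kick l x) = minus (kato l x) (laplace U l x).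
Proof.
intros Hl. apply (lim_unique (F := eventually) (fun n => kato_sum l n (kick l x))).
- now apply kato_lim.
- eapply filterlim_ext; [|apply (lim_minus (F := eventually));
    [exact (lim_seq_incr_1 _ _ (kato_lim l x Hl))|apply (filterlim_const (laplace U l x))]].
  intros n. cbv beta. rewrite <- kato_sum_kick by auto. vec.
Qed.

Lemma kato_kick_iter l n x : 0 < l ->
  kato l (Nat.iter (S n) (kick l) x) = minus (kato l x) (kato_sum l n x).
Proof.
intros Hl. induction n as [|n IH].
- unfold kato_sum. rewrite sum_n_0. now apply kato_kick.
- change (Nat.iter (S (S n)) (kick l) x) with (kick l (Nat.iter (S n) (kick l) x)).
  rewrite kato_kick, IH by auto. unfold kato_sum. rewrite sum_n_S.
  unfold kato_term at 3. vec.
Qed.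

(** The remainder K^n x itself need not tend to zero, and its surviving mass is the defect studied
    below. Only its image under [kato l] vanishes, because that image is the tail of a convergent
    series. *)
Lemma kato_kick_iter_lim l x : 0 < l ->
  filterlim (fun n => kato l (Nat.iter (S n) (kick l) x)) eventually (locally zero).
Proof.
intros Hl. replace zero with (minus (kato l x) (kato l x)) by vec.
eapply filterlim_ext; [intros n; symmetry; now apply kato_kick_iter|].
apply (lim_minus (F := eventually)); [apply filterlim_const|now apply kato_lim].
Qed.

(** With f = l w - v, the resolvent of [U] sends f to [w], and B w = K f. So the argument is f - K
    f, and [kato_kick] leaves only the first term of the series for f. *)
Lemma kato_generator_at l w v : 0 < l -> is_generator_at U w v ->
  kato l (minus (minus (scal l w) v) (B w)) = w.
Proof.
intros Hl H. assert (E := laplace_generator_at HX HPsi HU l w v Hl H).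
rewrite (pm_minus _ _ (kato_pm l Hl)).
replace (B w) with (kick l (minus (scal l w) v)) by (unfold kick; now rewrite E).
rewrite kato_kick, E by auto. vec.
Qed.

Lemma kato_sum_generator_at l n x : 0 < l -> exists v,
  is_generator_at U (kato_sum l n x) v /\
  plus v (B (kato_sum l n x)) =
    plus (minus (scal l (kato_sum l n x)) x) (Nat.iter (S n) (kick l) x).
Proof.
intros Hl. induction n as [|n [v [Hv Ev]]]; unfold kato_sum in *.
- rewrite sum_n_0. eexists; split; [now apply (generator_at_laplace HX HPsi HU)|].
  unfold kato_term; simpl; unfold kick. vec.
- rewrite sum_n_S.
  assert (HR := generator_at_laplace HX HPsi HU l (Nat.iter (S n) (kick l) x) Hl).
  eexists; split; [exact (generator_at_plus HU _ _ _ _ Hv HR)|].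
  rewrite (op_plus HBlin); [|now apply dom_generator_at with v|now apply dom_laplace].
  change (Nat.iter (S (S n)) (kick l) x) with (B (laplace U l (Nat.iter (S n) (kick l) x))).
  unfold kato_term.
  set (w := sum_n _ n) in *. set (y := Nat.iter (S n) (kick l) x) in *.
  transitivity (plus (plus v (B w)) (plus (minus (scal l (laplace U l y)) y) (B (laplace U l y)))).
  { unfold kato_term. vec. }
  rewrite Ev. vec.
Qed.

(** * Monotonicity in the parameter and the resolvent identity *)

Lemma laplace_decr l m u : 0 < m <= l -> P u -> P (minus (laplace U m u) (laplace U l u)).
Proof.
intros Hlm Hu. assert (Hl : 0 < l) by lra. assert (Hm : 0 < m) by lra.
rewrite (laplace_identity HX HPsi HU l m u) by auto.
rewrite <- (pm_minus _ _ (laplace_pm HX HPsi HU l Hl)).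
apply (pm_pos _ _ _ (laplace_pm HX HPsi HU l Hl)).
rewrite minus_plus_l. apply (cone_scal HX); [lra|].
now apply (pm_pos _ _ _ (laplace_pm HX HPsi HU m Hm)).
Qed.

Lemma kick_decr l m u : 0 < m <= l -> P u -> P (minus (kick m u) (kick l u)).
Proof.
intros Hlm Hu. unfold kick.
destruct (op_minus (laplace U m u) (laplace U l u)) as [Hd <-]; try (apply dom_laplace; lra).
apply HBpos; auto. now apply laplace_decr.
Qed.

Lemma kick_iter_decr l m n u : 0 < m <= l -> P u ->
  P (minus (Nat.iter n (kick m) u) (Nat.iter n (kick l) u)).
Proof.
intros Hlm Hu. induction n as [|n IH]; simpl.
- rewrite minus_self. apply (cone_zero HX).
- apply (cone_le_trans HX) with (kick m (Nat.iter n (kick l) u)).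
  + apply kick_decr; auto. apply (pm_pos _ _ _ (kick_iter_pm l n ltac:(lra))); auto.
  + assert (HK := kick_pm m ltac:(lra)).
    rewrite <- (pm_minus _ _ HK). now apply (pm_pos _ _ _ HK).
Qed.

Lemma kato_decr l m u : 0 < m <= l -> P u -> P (minus (kato m u) (kato l u)).
Proof.
intros Hlm Hu.
apply (cone_lim HX (F := eventually) (fun n => minus (kato_sum m n u) (kato_sum l n u))).
- apply (lim_minus (F := eventually)); apply kato_lim; lra.
- apply filter_forall. intros n.
  assert (Ht : forall k, P (minus (kato_term m k u) (kato_term l k u))).
  { intros k. unfold kato_term.
    apply (cone_le_trans HX) with (laplace U m (Nat.iter k (kick l) u)).
    - apply laplace_decr; auto. apply (pm_pos _ _ _ (kick_iter_pm l k ltac:(lra))); auto.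
    - assert (HR := laplace_pm HX HPsi HU m ltac:(lra)).
      rewrite <- (pm_minus _ _ HR). apply (pm_pos _ _ _ HR). now apply kick_iter_decr. }
  unfold kato_sum. induction n as [|n IH].
  + rewrite !sum_n_0. apply Ht.
  + rewrite !sum_n_S, minus_plus_plus. now apply (cone_plus HX).
Qed.

(** [kato l] is a left inverse of l - A - B, and it is applied to the partial sums of the series for
    [m]. What remains is [kato l] of K_m^(n+1) u; as [m <= l], it lies below [kato m] of the same
    vector, which tends to zero. *)
Lemma kato_identity_decr l m x : 0 < m <= l ->
  kato m x = plus (kato l x) (scal (l - m) (kato l (kato m x))).
Proof.
intros Hlm. assert (Hl : 0 < l) by lra. assert (Hm : 0 < m) by lra.
assert (HSl := kato_pm l Hl). assert (HSm := kato_pm m Hm).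
(* Since [m <= l] both sides are positive maps, so the identity need only be checked on the cone,
   where domination controls norms. The second constant merely adds the bounds of the two
   summands. *)
apply (pm_eq_cone HX (P := P) (/ m) (/ l + ((l - m) * (/ l * / m))) (kato m)
  (fun x => plus (kato l x) (scal (l - m) (kato l (kato m x))))); auto.
{ assert (H2 := pm_scale HX HPsi _ _ (l - m) ltac:(lra)
    (pm_comp _ _ _ _ (Rlt_le _ _ (Rinv_0_lt_compat l Hl)) HSl HSm)).
  split.
  - intros a b. rewrite (pm_plus _ _ _ HSm), !(pm_plus _ _ _ HSl). vec.
  - intros r a. rewrite (pm_scal _ _ _ HSm), !(pm_scal _ _ _ HSl). vec.
  - intros a Ha. apply (cone_plus HX); [now apply (pm_pos _ _ _ HSl)|now apply (pm_pos _ _ _ H2)].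
  - intros a Ha. rewrite (cone_norm_additive HX).
    + generalize (pm_bound _ _ _ HSl a Ha) (pm_bound _ _ _ H2 a Ha). lra.
    + now apply (pm_pos _ _ _ HSl).
    + now apply (pm_pos _ _ _ H2). }
clear x. intros u Hu.
apply (lim_unique (F := eventually) (fun n => kato_sum m n u)); [now apply kato_lim|].
apply filterlim_ext with (fun n => minus (plus (kato l u) (scal (l - m) (kato l (kato_sum m n u))))
  (kato l (Nat.iter (S n) (kick m) u))).
{ intros n. destruct (kato_sum_generator_at m n u Hm) as (v & Hv & Ev).
  rewrite <- (kato_generator_at l _ _ Hl Hv) at 2.
  rewrite <- (pm_scal _ _ _ HSl), <- (pm_plus _ _ _ HSl), <- (pm_minus _ _ HSl). f_equal.
  transitivity (minus (scal l (kato_sum m n u)) (plus v (B (kato_sum m n u)))); [|vec].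
  rewrite Ev. vec. }
assert (H0 : filterlim (fun n => kato l (Nat.iter (S n) (kick m) u)) eventually (locally zero)).
{ apply (lim_squeeze (F := eventually)) with (fun n => norm (minus (kato m (Nat.iter (S n) (kick m) u)) zero)).
  - apply filter_forall. intros n.
    assert (HP := pm_pos _ _ _ (kick_iter_pm m (S n) Hm) u Hu).
    replace (minus (kato l (Nat.iter (S n) (kick m) u)) zero)
      with (kato l (Nat.iter (S n) (kick m) u)) by vec.
    replace (minus (kato m (Nat.iter (S n) (kick m) u)) zero)
      with (kato m (Nat.iter (S n) (kick m) u)) by vec.
    apply (cone_norm_mono HX HPsi); [now apply (pm_pos _ _ _ HSl)|now apply kato_decr].
  - apply (lim_seq_norm). now apply kato_kick_iter_lim. }
assert (H1 := lim_scal (F := eventually) (l - m) _ _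
  (lim_linear (F := eventually) (kato l) _ _ (kato_linear l Hl) (kato_lim m u Hm))).
assert (H2 := lim_minus (F := eventually) _ _ _ _
  (lim_plus (F := eventually) _ _ _ _ (filterlim_const (kato l u)) H1) H0).
replace (minus (plus (kato l u) (scal (l - m) (kato l (kato m u)))) zero)
  with (plus (kato l u) (scal (l - m) (kato l (kato m u)))) in H2 by vec.
exact H2.
Qed.

(* With [D] the commutator and [q = (l - m) / l < 1], the resolvent identity gives
   [D = (l - m) kato l D], so [D] is fixed by a strict contraction. *)
Lemma kato_comm_lt l m x : 0 < m < l -> kato l (kato m x) = kato m (kato l x).
Proof.
intros Hlm. assert (Hl : 0 < l) by lra. assert (Hm : 0 < m) by lra.
assert (HS := kato_pm l Hl).
assert (HL := pm_scale HX HPsi _ _ (l - m) ltac:(lra) HS).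
set (D := minus (kato l (kato m x)) (kato m (kato l x))).
assert (ED : scal (l - m) (kato l D) = D).
{ unfold D at 1. rewrite (pm_minus _ _ HS).
  assert (E1 := kato_identity_decr l m (kato l x) ltac:(lra)).
  assert (E2 := f_equal (kato l) (kato_identity_decr l m x ltac:(lra))).
  rewrite (pm_plus _ _ _ HS), (pm_scal _ _ _ HS) in E2.
  unfold D. rewrite E1 at 2. rewrite E2 at 2. vec. }
destruct (cone_ball_bound HX HPsi) as (M & HM & HB).
assert (Hq : 0 <= (l - m) * / l < 1).
{ split.
  - apply Rmult_le_pos; [lra|left; now apply Rinv_0_lt_compat].
  - apply Rmult_lt_reg_r with l; auto. rewrite Rmult_assoc, Rinv_l; lra. }
assert (H : forall n, cone_ball (P := P) D (((l - m) * / l) ^ n * (M * norm D))).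
{ induction n as [|n IH].
  - simpl. rewrite Rmult_1_l. apply HB.
  - rewrite <- ED at 1. simpl. rewrite Rmult_assoc.
    apply (pm_cone_ball _ _ _ _ (proj1 Hq) HL IH). }
apply minus_zero_eq. apply (norm_eq_zero D). apply Rle_antisym; [|apply norm_ge_0].
apply is_lim_seq_le_real with (fun _ => norm D) (fun n => ((l - m) * / l) ^ n * (M * norm D)).
- intros n. apply (cone_ball_norm (P := P)). apply H.
- apply is_lim_seq_const.
- assert (H1 := is_lim_seq_scal_r _ (M * norm D) _
    (is_lim_seq_geom ((l - m) * / l) ltac:(rewrite Rabs_pos_eq; lra))).
  simpl in H1. rewrite Rmult_0_l in H1. exact H1.
Qed.

Lemma kato_comm l m x : 0 < l -> 0 < m -> kato l (kato m x) = kato m (kato l x).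
Proof.
intros Hl Hm. destruct (Rtotal_order l m) as [H|[<-|H]].
- symmetry. apply kato_comm_lt; lra.
- reflexivity.
- apply kato_comm_lt; lra.
Qed.

(** For [m > l] the identity with the roles exchanged has its two factors in the wrong order;
    commutation repairs this. *)
Lemma kato_identity l m x : 0 < l -> 0 < m ->
  kato m x = plus (kato l x) (scal (l - m) (kato l (kato m x))).
Proof.
intros Hl Hm. destruct (Rle_dec m l) as [H|H].
- now apply kato_identity_decr.
- assert (E := kato_identity_decr m l x ltac:(lra)).
  rewrite (kato_comm m l) in E by auto. rewrite E at 1. vec.
Qed.

End Perturbation.

Arguments kick {X} U B l x.
Arguments kato_term {X} U B l n x.
Arguments kato_sum {X} U B l n x.
Arguments kato {X} U B l x.

(** * Generation by implicit Euler schemes *)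

Lemma iter_double {A} (f : A -> A) n x :
  Nat.iter (2 * n) f x = Nat.iter n (fun y => f (f y)) x.
Proof.
induction n as [|n IH]; auto.
replace (2 * S n)%nat with (S (S (2 * n))) by lia. simpl in *. now rewrite IH.
Qed.

Lemma iter_swap {A} (f g : A -> A) n x :
  (forall y, f (g y) = g (f y)) -> Nat.iter n f (g x) = g (Nat.iter n f x).
Proof. intros H. induction n as [|n IH]; simpl; auto. now rewrite IH. Qed.

Lemma iter_comp {A} (f g : A -> A) n x : (forall y, f (g y) = g (f y)) ->
  Nat.iter n (fun y => f (g y)) x = Nat.iter n f (Nat.iter n g x).
Proof.
intros H. induction n as [|n IH]; simpl; auto.
rewrite IH, (iter_swap f g) by auto. reflexivity.
Qed.

(** A pseudo-resolvent with dense range generates a substochastic semigroup: the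
    limit of the implicit Euler schemes [J(t / n)^n], [J(h) = h^-1 S(h^-1)]. On
    [graph w y], [graph y z] one has [J(h) J(k) w - J(h + k) w = O((h + k)^2)], so that
    refining the time grid is a Cauchy process. *)
Section HilleYosida.
Context {X : CompleteNormedModule R_AbsRing} {P : X -> Prop} {Psi : X -> R}
  (HX : is_abstract_state_space P) (HPsi : is_norm_functional P Psi)
  (S : R -> X -> X)
  (S_pm : forall l, 0 < l -> positive_map P (/ l) (S l))
  (S_comm : forall l m x, 0 < l -> 0 < m -> S l (S m x) = S m (S l x))
  (S_identity : forall l m x, 0 < l -> 0 < m ->
     S m x = Hierarchy.plus (S l x) (Hierarchy.scal (l - m) (S l (S m x))))
  (S_dense : dense (fun w : X => exists x, w = S 1 x)).

Local Notation zero := (@Hierarchy.zero X).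
Local Notation plus := (@Hierarchy.plus X).
Local Notation opp := (@Hierarchy.opp X).
Local Notation minus := (@Hierarchy.minus X).
Local Notation scal := (@Hierarchy.scal R_AbsRing X).
Local Notation norm := (@Hierarchy.norm R_AbsRing X).
Local Notation sum_n := (@Hierarchy.sum_n X).
Local Notation ball := (cone_ball (P := P)).

(** The generator of the pseudo-resolvent, kept as a relation: injectivity of [S l] is not assumed,
    so [y] is not yet a function of [w]. *)
Definition graph (w y : X) : Prop :=
  forall l, 0 < l -> S l (minus (scal l w) y) = w.

Lemma graph_S l x : 0 < l -> graph (S l x) (minus (scal l (S l x)) x).
Proof.
intros Hl m Hm. assert (H := S_pm m Hm).
rewrite (S_identity m l x Hm Hl) at 3.
rewrite <- (pm_scal _ _ _ H), <- (pm_plus _ _ _ H). f_equal. vec.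
Qed.

Lemma graph_minus w w' y y' : graph w y -> graph w' y' -> graph (minus w w') (minus y y').
Proof.
intros H H' l Hl. rewrite <- (H l Hl) at 2. rewrite <- (H' l Hl) at 2.
rewrite <- (pm_minus _ _ (S_pm l Hl)). f_equal. vec.
Qed.

(** The default value at [h <= 0] makes J(0) the identity, as the schemes at time 0 require. *)
Definition euler (h : R) (x : X) : X :=
  if Rlt_dec 0 h then scal (/ h) (S (/ h) x) else x.

Lemma euler_pm h : positive_map P 1 (euler h).
Proof.
unfold euler. destruct (Rlt_dec 0 h) as [Hh|Hh]; [|apply pm_id].
assert (Hh' := Rinv_0_lt_compat h Hh).
rewrite <- (Rinv_r (/ h)) by lra. apply (pm_scale HX HPsi); [lra|]. now apply S_pm.
Qed.

Lemma euler_comm h k x : euler h (euler k x) = euler k (euler h x).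
Proof.
unfold euler. destruct (Rlt_dec 0 h) as [Hh|Hh], (Rlt_dec 0 k) as [Hk|Hk]; auto.
assert (Hh' := Rinv_0_lt_compat h Hh). assert (Hk' := Rinv_0_lt_compat k Hk).
rewrite (pm_scal _ _ _ (S_pm _ Hh')), (pm_scal _ _ _ (S_pm _ Hk')), S_comm by auto. vec; lra.
Qed.

(** This is J(h) w = w + h J(h) y: each use spends one step along the graph and gains one factor
    [h]. *)
Lemma euler_graph h w y : 0 <= h -> graph w y ->
  euler h w = plus w (scal h (euler h y)).
Proof.
intros Hh H. unfold euler. destruct (Rlt_dec 0 h) as [Hh1|Hh1].
- assert (Hh' := Rinv_0_lt_compat h Hh1). specialize (H (/ h) Hh').
  rewrite (pm_minus _ _ (S_pm _ Hh')), (pm_scal _ _ _ (S_pm _ Hh')) in H.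
  transitivity (plus (minus (scal (/ h) (S (/ h) w)) (S (/ h) y)) (S (/ h) y)); [vec|].
  rewrite H. vec; lra.
- replace h with 0 by lra. vec.
Qed.

Lemma pm1_ball L x r : positive_map P 1 L -> ball x r -> ball (L x) r.
Proof.
intros HL H. rewrite <- (Rmult_1_l r). apply (pm_cone_ball 1 L); auto. lra.
Qed.

(** Expanding once along the graph at [w] leaves differences of Euler steps at [y], with a factor
    [h] or [k]. Expanding again at [y] cancels the terms of first order, and each remaining term
    carries two step sizes and the vector [z]. *)
Lemma euler_step h k w y z r : 0 <= h -> 0 <= k -> graph w y -> graph y z -> ball z r ->
  ball (minus (euler h (euler k w)) (euler (h + k) w)) (2 * (h + k) ^ 2 * r).
Proof.
intros Hh Hk Hw Hy Hr. assert (Hhk : 0 <= h + k) by lra.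
assert (Hr0 := cone_ball_nonneg _ _ Hr).
assert (Jh := euler_pm h). assert (Jhk := euler_pm (h + k)).
assert (E1 : minus (euler h y) (euler (h + k) y) =
  minus (scal h (euler h z)) (scal (h + k) (euler (h + k) z))).
{ rewrite (euler_graph h y z), (euler_graph (h + k) y z) by auto. vec. }
assert (E2 : minus (euler h (euler k y)) (euler (h + k) y) =
  minus (plus (scal h (euler h z)) (scal k (euler h (euler k z))))
    (scal (h + k) (euler (h + k) z))).
{ rewrite (euler_graph k y z), (pm_plus _ _ _ Jh), (pm_scal _ _ _ Jh),
    (euler_graph h y z), (euler_graph (h + k) y z) by auto. vec. }
assert (E : minus (euler h (euler k w)) (euler (h + k) w) =
  plus (scal h (minus (euler h y) (euler (h + k) y)))
       (scal k (minus (euler h (euler k y)) (euler (h + k) y)))).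
{ rewrite (euler_graph k w y), (pm_plus _ _ _ Jh), (pm_scal _ _ _ Jh),
    (euler_graph h w y), (euler_graph (h + k) w y) by auto. vec. }
assert (Bh : ball (scal h (euler h z)) (h * r)).
{ apply (cone_ball_scal HX HPsi); auto. now apply pm1_ball. }
assert (Bhk : ball (scal (h + k) (euler (h + k) z)) ((h + k) * r)).
{ apply (cone_ball_scal HX HPsi); auto. now apply pm1_ball. }
assert (Bk : ball (scal k (euler h (euler k z))) (k * r)).
{ apply (cone_ball_scal HX HPsi); auto. apply pm1_ball, pm1_ball; auto. apply euler_pm. }
rewrite E, E1, E2.
apply cone_ball_le with (h * (h * r + (h + k) * r) + k * (h * r + k * r + (h + k) * r)).
(* The contributions sum to (2 h^2 + 3 h k + 2 k^2) r, which falls short of the bound by h k r. *)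
{ assert (0 <= h * k * r) by (apply Rmult_le_pos; auto; now apply Rmult_le_pos). nra. }
apply (cone_ball_plus HX); apply (cone_ball_scal HX HPsi); auto;
  apply (cone_ball_minus HX); auto.
now apply (cone_ball_plus HX).
Qed.

(** Telescoping: by commutation L^n - K^n is a sum of [n] terms, each a product of cone contractions
    applied to L w - K w. *)
Lemma iter_diff_ball (L K : X -> X) w r n :
  positive_map P 1 L -> positive_map P 1 K -> (forall x, L (K x) = K (L x)) ->
  ball (minus (L w) (K w)) r ->
  ball (minus (Nat.iter n L w) (Nat.iter n K w)) (INR n * r).
Proof.
intros HL HK HLK H. induction n as [|n IH].
- simpl. rewrite Rmult_0_l, minus_self. exists zero, zero.
  repeat split; try apply (cone_zero HX); [vec|]. rewrite norm_0. lra.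
- replace (minus (Nat.iter (Datatypes.S n) L w) (Nat.iter (Datatypes.S n) K w)) with
    (plus (Nat.iter n L (minus (L w) (K w))) (K (minus (Nat.iter n L w) (Nat.iter n K w)))).
  2: { rewrite (pm_minus _ _ HK), (pm_minus _ _ (pm_iter L n HL)).
       rewrite (iter_swap L K), (iter_swap L L) by auto. simpl. vec. }
  rewrite S_INR, Rmult_plus_distr_r, Rmult_1_l, Rplus_comm.
  apply (cone_ball_plus HX); apply pm1_ball; auto. now apply pm_iter.
Qed.

(** Numbers of steps are powers of two, so that passing to the next index splits every step into two
    equal halves. *)
Definition scheme (k : nat) (t : R) : X -> X := Nat.iter (2 ^ k) (euler (t / 2 ^ k)).

Lemma pow2_pos k : 0 < 2 ^ k.
Proof. apply pow_lt; lra. Qed.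

Lemma INR_pow2 k : INR (2 ^ k) = 2 ^ k.
Proof. rewrite pow_INR. reflexivity. Qed.

Lemma scheme_pm k t : positive_map P 1 (scheme k t).
Proof. apply pm_iter, euler_pm. Qed.

Lemma scheme_0 k x : scheme k 0 x = x.
Proof.
unfold scheme. replace (0 / 2 ^ k) with 0 by (unfold Rdiv; ring).
unfold euler. destruct (Rlt_dec 0 0) as [H|_]; [lra|].
generalize (2 ^ k)%nat. intros n. induction n as [|n IH]; auto.
Qed.

Lemma scheme_refine k t w y z r : 0 <= t -> graph w y -> graph y z -> ball z r ->
  ball (minus (scheme (Datatypes.S k) t w) (scheme k t w)) (2 * t ^ 2 * r * (/ 2) ^ k).
Proof.
intros Ht Hw Hy Hr. unfold scheme. generalize (pow2_pos k); intros H2.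
assert (Hh : 0 <= t / 2 ^ k / 2).
{ apply Rmult_le_pos; [|lra]. apply Rmult_le_pos; auto. left; now apply Rinv_0_lt_compat. }
change (2 ^ Datatypes.S k)%nat with (2 * 2 ^ k)%nat. rewrite iter_double.
replace (t / 2 ^ Datatypes.S k) with (t / 2 ^ k / 2) by (simpl; field; lra).
set (h := t / 2 ^ k / 2) in *.
assert (Et : t / 2 ^ k = h + h) by (unfold h; lra). rewrite Et.
replace (2 * t ^ 2 * r * (/ 2) ^ k) with (INR (2 ^ k) * (2 * (h + h) ^ 2 * r)).
2: { rewrite INR_pow2, pow_inv. unfold h. field. lra. }
apply iter_diff_ball.
- apply pm_comp1; apply euler_pm.
- apply euler_pm.
- intros x. cbv beta. rewrite (euler_comm h (h + h) x), (euler_comm h (h + h) (euler h x)). reflexivity.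
- now apply euler_step with y z.
Qed.

Lemma graph2_dense : dense (fun w => exists y z, graph w y /\ graph y z).
Proof.
intros x eps He. destruct (pm_norm_bound HX HPsi) as (M & HM & HB).
destruct (S_dense x (eps / 2)) as (w & (f & ->) & H1); [lra|].
destruct (S_dense f (eps / (2 * M))) as (w & (g & ->) & H2).
{ apply Rdiv_lt_0_compat; lra. }
(* Two applications of [S 1] provide two successive steps along the graph. Boundedness of [S 1]
   carries the approximation of [f] by [S 1 g] over to [S 1 f]. *)
exists (S 1 (S 1 g)). split.
- exists (minus (scal 1 (S 1 (S 1 g))) (S 1 g)).
  exists (minus (minus (scal 1 (S 1 (S 1 g))) (S 1 g)) (minus (scal 1 (S 1 g)) g)).
  split; [apply graph_S; lra|]. apply graph_minus; [|apply graph_S; lra].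
  replace (scal 1 (S 1 (S 1 g))) with (S 1 (S 1 g)) at 1 by vec. apply graph_S; lra.
- apply Rle_lt_trans with (1 := norm_minus_triangle x (S 1 f) _).
  rewrite <- (pm_minus _ _ (S_pm 1 Rlt_0_1)).
  assert (norm (S 1 (minus f (S 1 g))) <= eps / 2); [|lra].
  apply Rle_trans with (1 := HB (/ 1) _ _ ltac:(lra) (S_pm 1 Rlt_0_1)).
  apply Rle_trans with (M * / 1 * (eps / (2 * M))).
  + apply Rmult_le_compat_l; lra.
  + right. field. lra.
Qed.

Definition euler_limit (t : R) (x : X) : X :=
  iota (fun y => filterlim (fun k => scheme k t x) eventually (locally y)).

Lemma euler_limit_lim t x : 0 <= t ->
  filterlim (fun k => scheme k t x) eventually (locally (euler_limit t x)).
Proof.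
intros Ht.
apply (iota_correct (fun y => filterlim (fun k => scheme k t x) eventually (locally y))).
destruct (pm_ex_lim_dense HX HPsi 1 (fun k => scheme k t)
  (fun w => exists y z, graph w y /\ graph y z)) with (x := x) as [y Hy].
- lra.
- intros k; apply scheme_pm.
- apply graph2_dense.
- intros w (y & z & Hw & Hy). destruct (cone_ball_bound HX HPsi) as (M & HM & HB).
  apply (seq_complete (fun k => scheme k t w) (fun k => 2 * t ^ 2 * (M * norm z) * (/ 2) ^ k)).
  + intros k. apply (cone_ball_norm (P := P)). now apply scheme_refine with y z.
  + apply ex_series_geom_scal. lra.
- exists y. split; auto. intros y' Hy'. now apply (lim_unique (F := eventually) _ _ _ Hy).
Qed.

Lemma euler_limit_pm t : 0 <= t -> positive_map P 1 (euler_limit t).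
Proof.
intros Ht. apply (pm_lim HX (F := eventually) 1 (fun k => scheme k t)).
- apply filter_forall. intros k; apply scheme_pm.
- intros x; now apply euler_limit_lim.
Qed.

(** Since Euler steps commute, the two schemes can be interleaved, and each pair J(s / 2^k) J(t /
    2^k) is compared with a single step; the 2^k errors are each of order 4^-k. *)
Lemma scheme_add k s t w y z r : 0 <= s -> 0 <= t -> graph w y -> graph y z -> ball z r ->
  ball (minus (scheme k s (scheme k t w)) (scheme k (s + t) w)) (2 * (s + t) ^ 2 * r * (/ 2) ^ k).
Proof.
intros Hs Ht Hw Hy Hr. unfold scheme. generalize (pow2_pos k); intros H2.
assert (H2' : 0 < / 2 ^ k) by now apply Rinv_0_lt_compat.
rewrite <- (iter_comp (euler (s / 2 ^ k)) (euler (t / 2 ^ k))) by (intros; apply euler_comm).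
replace ((s + t) / 2 ^ k) with (s / 2 ^ k + t / 2 ^ k) by (field; lra).
replace (2 * (s + t) ^ 2 * r * (/ 2) ^ k) with
  (INR (2 ^ k) * (2 * (s / 2 ^ k + t / 2 ^ k) ^ 2 * r)).
2: { rewrite INR_pow2, pow_inv. field. lra. }
apply iter_diff_ball.
- apply pm_comp1; apply euler_pm.
- apply euler_pm.
- intros x. cbv beta. now rewrite (euler_comm (t / 2 ^ k)), (euler_comm (s / 2 ^ k)).
- apply euler_step with y z; auto; apply Rmult_le_pos; lra.
Qed.

Lemma geom_half_lim (C : R) : is_lim_seq (fun k => C * (/ 2) ^ k) 0.
Proof.
assert (H := is_lim_seq_scal_l _ C _ (is_lim_seq_geom (/ 2) ltac:(rewrite Rabs_pos_eq; lra))).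
simpl in H. rewrite Rmult_0_r in H. exact H.
Qed.

Lemma euler_limit_add s t x : 0 <= s -> 0 <= t ->
  euler_limit (s + t) x = euler_limit s (euler_limit t x).
Proof.
intros Hs Ht. assert (Hst : 0 <= s + t) by lra.
assert (Hcomp := pm_comp1 _ _ (euler_limit_pm s Hs) (euler_limit_pm t Ht)).
apply (lim_unique (F := eventually) (fun k => scheme k (s + t) x)); [now apply euler_limit_lim|].
revert x. apply (pm_lim_dense HX HPsi (F := eventually) 1 (fun k => scheme k (s + t))
  (fun x => euler_limit s (euler_limit t x)) (fun w => exists y z, graph w y /\ graph y z)); auto.
- lra.
- apply filter_forall. intros k; apply scheme_pm.
- apply graph2_dense.
- intros w (y & z & Hw & Hy). destruct (cone_ball_bound HX HPsi) as (M & HM & HB).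
  assert (H1 : filterlim (fun k => scheme k s (scheme k t w)) eventually
    (locally (euler_limit s (euler_limit t w)))).
  { apply (pm_lim_comp HX HPsi (F := eventually) 1 (fun k => scheme k s)) with (euler_limit t w).
    - lra.
    - apply filter_forall. intros k; apply scheme_pm.
    - now apply euler_limit_lim.
    - now apply euler_limit_lim. }
  assert (H2 : filterlim (fun k => minus (scheme k s (scheme k t w)) (scheme k (s + t) w))
    eventually (locally zero)).
  { apply (lim_squeeze (F := eventually)) with (2 := geom_half_lim (2 * (s + t) ^ 2 * (M * norm z))).
    apply filter_forall. intros k.
    apply (cone_ball_norm (P := P)).
    replace (minus (minus (scheme k s (scheme k t w)) (scheme k (s + t) w)) zero)
      with (minus (scheme k s (scheme k t w)) (scheme k (s + t) w)) by vec.
    now apply scheme_add with y z. }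
  assert (H3 := lim_minus (F := eventually) _ _ _ _ H1 H2).
  replace (minus (euler_limit s (euler_limit t w)) zero)
    with (euler_limit s (euler_limit t w)) in H3 by vec.
  eapply filterlim_ext; [|exact H3]. intros k. cbv beta. vec.
Qed.

Lemma euler_iter_move n h w y r : 0 <= h -> graph w y -> ball y r ->
  ball (minus (Nat.iter n (euler h) w) w) (INR n * h * r).
Proof.
intros Hh Hw Hr. induction n as [|n IH].
- simpl. rewrite minus_self, !Rmult_0_l. exists zero, zero.
  repeat split; try apply (cone_zero HX); [vec|]. rewrite norm_0. lra.
- rewrite Nat.iter_succ_r, (euler_graph h w y Hh Hw).
  assert (HI := pm_iter _ n (euler_pm h)).
  rewrite (pm_plus _ _ _ HI), (pm_scal _ _ _ HI).
  replace (minus _ _) with (plus (minus (Nat.iter n (euler h) w) w)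
    (scal h (Nat.iter n (euler h) (euler h y)))) by vec.
  rewrite S_INR. replace ((INR n + 1) * h * r) with (INR n * h * r + h * r) by ring.
  apply (cone_ball_plus HX); auto. apply (cone_ball_scal HX HPsi); auto.
  apply pm1_ball; auto. apply pm1_ball; auto. apply euler_pm.
Qed.

(** A first-order expansion that asks regularity only of the part [z] of the derivative. The drift
    of [z] costs elapsed time times [r]; the rough part [e] is not differentiated and enters through
    its size, once before and once after the steps. *)
Lemma euler_iter_expand n h w z z' e a r : 0 <= h -> 0 <= a ->
  graph w (plus z e) -> graph z z' -> ball e a -> ball z' r ->
  ball (minus (minus (Nat.iter n (euler h) w) w) (scal (INR n * h) (plus z e)))
    (INR n * h * (2 * a + INR n * h * r)).
Proof.
intros Hh Ha Hw Hz He Hr. assert (Hr0 := cone_ball_nonneg _ _ Hr).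
induction n as [|n IH].
- simpl. rewrite !Rmult_0_l. exists zero, zero.
  repeat split; try apply (cone_zero HX); [vec|]. rewrite norm_0. lra.
- assert (HI := pm_iter _ n (euler_pm h)).
  assert (HI' := pm_iter _ (Datatypes.S n) (euler_pm h)).
  assert (E : Nat.iter (Datatypes.S n) (euler h) w =
    plus (Nat.iter n (euler h) w) (scal h (Nat.iter (Datatypes.S n) (euler h) (plus z e)))).
  { rewrite !Nat.iter_succ_r, (euler_graph h _ _ Hh Hw) at 1.
    now rewrite (pm_plus _ _ _ HI), (pm_scal _ _ _ HI). }
  rewrite E, (pm_plus _ _ _ HI'), S_INR.
  replace (minus _ _) with (plus
    (minus (minus (Nat.iter n (euler h) w) w) (scal (INR n * h) (plus z e)))
    (scal h (plus (minus (Nat.iter (Datatypes.S n) (euler h) z) z)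
      (minus (Nat.iter (Datatypes.S n) (euler h) e) e)))) by vec.
  apply cone_ball_le with (INR n * h * (2 * a + INR n * h * r)
     + h * (INR (Datatypes.S n) * h * r + (a + a))).
  { rewrite S_INR. assert (Hn := pos_INR n).
    assert (0 <= INR n * h * (h * r)) by (repeat apply Rmult_le_pos; auto). nra. }
  apply (cone_ball_plus HX); auto. apply (cone_ball_scal HX HPsi); auto.
  apply (cone_ball_plus HX).
  + now apply euler_iter_move with z'.
  + apply (cone_ball_minus HX); auto. now apply pm1_ball.
Qed.

Lemma scheme_step k t : 0 <= t -> 0 <= t / 2 ^ k /\ INR (2 ^ k) * (t / 2 ^ k) = t.
Proof.
intros Ht. generalize (pow2_pos k); intros H2. split.
- apply Rmult_le_pos; auto. left; now apply Rinv_0_lt_compat.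
- rewrite INR_pow2. field. lra.
Qed.

Lemma euler_limit_move t w y r : 0 <= t -> graph w y -> ball y r ->
  norm (minus (euler_limit t w) w) <= t * r.
Proof.
intros Ht Hw Hr. apply (lim_norm_le (F := eventually) (fun k => scheme k t w)).
- now apply euler_limit_lim.
- apply filter_forall. intros k. destruct (scheme_step k t Ht) as [Hh Et].
  assert (HE := euler_iter_move (2 ^ k) _ w y r Hh Hw Hr). rewrite Et in HE.
  apply (cone_ball_norm (P := P)). exact HE.
Qed.

Lemma euler_limit_generator_at w y : graph w y -> is_generator_at euler_limit w y.
Proof.
intros Hw. apply lim_norm. intros eps Heps.
destruct (cone_ball_bound HX HPsi) as (M & HM & HB).
(* [y] may have no graph successor, so it is replaced by a nearby [z] that has one. The difference
   contributes at most [eps / 2] and the drift of [z] at most [eps / 4]. *)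
destruct (graph2_dense y (eps / (4 * M))) as (z & (z' & _ & Hz & _) & Hyz).
{ apply Rdiv_lt_0_compat; lra. }
set (e := minus y z) in *.
assert (Ey : y = plus z e) by (unfold e; vec).
set (r := M * norm z').
assert (Hr : 0 <= r) by (apply (cone_ball_nonneg (P := P) z'), HB).
assert (Ha : M * norm e <= eps / 4).
{ apply Rle_trans with (M * (eps / (4 * M))); [apply Rmult_le_compat_l; lra|right; field; lra]. }
assert (Ha0 : 0 <= M * norm e) by (apply (cone_ball_nonneg (P := P) e), HB).
generalize (at_right_lt (eps / (4 * (r + 1))) ltac:(apply Rdiv_lt_0_compat; lra)).
apply filter_imp. intros t Ht.
assert (Htr : t * r <= eps / 4).
{ apply Rle_trans with (eps / (4 * (r + 1)) * (r + 1)).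
  - apply Rmult_le_compat; lra.
  - right; field; lra. }
assert (H : norm (minus (euler_limit t w) (plus w (scal t y))) <= t * (2 * (M * norm e) + t * r)).
{ apply (lim_norm_le (F := eventually) (fun k => scheme k t w)).
  - apply euler_limit_lim; lra.
  - apply filter_forall. intros k. destruct (scheme_step k t ltac:(lra)) as [Hh Et].
    replace (minus (scheme k t w) (plus w (scal t y)))
      with (minus (minus (scheme k t w) w) (scal t (plus z e))) by (rewrite Ey; vec).
    assert (HE := euler_iter_expand (2 ^ k) _ w z z' e (M * norm e) r Hh Ha0).
    rewrite Et in HE. apply (cone_ball_norm (P := P)). apply HE; auto.
    now rewrite <- Ey. }
change (norm (minus (scal (/ t) (minus (euler_limit t w) w)) y) < eps).
replace (minus (scal (/ t) (minus (euler_limit t w) w)) y) with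
  (scal (/ t) (minus (euler_limit t w) (plus w (scal t y)))) by (vec; lra).
assert (Ht' : 0 < / t) by (apply Rinv_0_lt_compat; lra).
eapply Rle_lt_trans; [apply norm_scal_le|]. rewrite Rabs_pos_eq by lra.
apply Rle_lt_trans with (/ t * (t * (2 * (M * norm e) + t * r))).
- apply Rmult_le_compat_l; lra.
- rewrite <- Rmult_assoc, Rinv_l by lra. lra.
Qed.

Lemma euler_limit_substochastic : is_substochastic P euler_limit.
Proof.
split; [split|split].
- intros t Ht. apply (pm_linear HX HPsi 1); [lra|]. now apply euler_limit_pm.
- intros x. apply (lim_unique (F := eventually) (fun k => scheme k 0 x)).
  + apply euler_limit_lim; lra.
  + apply filterlim_ext with (fun _ => x); [|apply filterlim_const].
    intros k; now rewrite scheme_0.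
- intros s t x Hs Ht. now apply euler_limit_add.
- intros x. destruct (cone_ball_bound HX HPsi) as (M & HM & HB).
  apply (pm_lim_dense HX HPsi (F := at_right 0) 1 euler_limit (fun x => x)
    (fun w => exists y z, graph w y /\ graph y z)).
  + lra.
  + generalize at_right_pos. apply filter_imp. intros t Ht. apply euler_limit_pm; lra.
  + apply pm_id.
  + apply graph2_dense.
  + intros w (y & _ & Hw & _).
    apply (lim_squeeze (F := at_right 0)) with (fun t => t * (M * norm y)).
    * generalize at_right_pos. apply filter_imp. intros t Ht.
      apply euler_limit_move with y; auto. lra.
    * assert (H : continuous (fun t => t * (M * norm y)) 0).
      { apply (@ex_derive_continuous R_AbsRing R_NormedModule). auto_derive. auto. }
      unfold continuous in H. rewrite Rmult_0_l in H.
      apply filterlim_filter_le_1 with (2 := H). apply filter_le_within.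
- intros t u Ht. apply (pm_pos _ _ _ (euler_limit_pm t Ht)).
- intros t u Ht Hu. rewrite <- (Rmult_1_l (norm u)).
  now apply (pm_bound _ _ _ (euler_limit_pm t Ht)).
Qed.

End HilleYosida.

(** * The minimal semigroup *)

Section Minimality.
Context {X : CompleteNormedModule R_AbsRing} {P : X -> Prop} {Psi : X -> R}
  (HX : is_abstract_state_space P) (HPsi : is_norm_functional P Psi)
  {U : R -> X -> X} (HU : is_substochastic P U) {B : operator X}
  (HBdom : forall w, dom B w <-> dom (generator U) w)
  (HBlin : is_linear_operator B)
  (HBpos : positive_operator P B)
  (HAB : forall w, dom (generator U) w -> P w ->
           (Psi (plus (generator U w) (B w)) <= 0)%R)
  {V : R -> X -> X} (HV : is_minimal_semigroup P (generator U) B V).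

Local Notation zero := (@Hierarchy.zero X).
Local Notation plus := (@Hierarchy.plus X).
Local Notation opp := (@Hierarchy.opp X).
Local Notation minus := (@Hierarchy.minus X).
Local Notation scal := (@Hierarchy.scal R_AbsRing X).
Local Notation norm := (@Hierarchy.norm R_AbsRing X).
Local Notation sum_n := (@Hierarchy.sum_n X).

Lemma minimal_substochastic : is_substochastic P V.
Proof. exact (proj1 HV). Qed.

Lemma minimal_generator_at w v :
  is_generator_at U w v -> is_generator_at V w (plus v (B w)).
Proof.
intros H. destruct (proj1 (proj2 HV) w) as [Hd E].
- split; [now exists v|now apply (dom_generator_at HBdom w v)].
- apply generator_dom in Hd. rewrite E in Hd.
  change (is_generator_at V w (plus (generator U w) (B w))) in Hd.
  now rewrite (generator_op w v H) in Hd.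
Qed.

(** By [kato_sum_generator_at], the resolvent of [V] maps u - K^(n+1) u to the partial sum. The
    difference in question is thus the resolvent of K^(n+1) u, which is positive. *)
Lemma kato_le_laplace l u : 0 < l -> P u -> P (minus (laplace V l u) (kato U B l u)).
Proof.
intros Hl Hu. assert (HQ := laplace_pm HX HPsi minimal_substochastic l Hl).
apply (cone_lim HX (F := eventually) (fun n => minus (laplace V l u) (kato_sum U B l n u))).
- apply (lim_minus (F := eventually)); [apply filterlim_const|].
  now apply (kato_lim HX HPsi HU HBdom HBlin HBpos HAB).
- apply filter_forall. intros n.
  destruct (kato_sum_generator_at HX HPsi HU HBdom HBlin l n u Hl) as (v & Hv & Ev).
  apply minimal_generator_at in Hv. rewrite Ev in Hv.
  rewrite <- (laplace_generator_at HX HPsi minimal_substochastic l _ _ Hl Hv).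
  rewrite <- (pm_minus _ _ HQ). apply (pm_pos _ _ _ HQ).
  replace (minus _ _) with (Nat.iter (S n) (kick U B l) u) by vec.
  now apply (pm_pos _ _ _ (kick_iter_pm HX HPsi HU HBdom HBlin HBpos HAB l (S n) Hl)).
Qed.

Lemma laplace_minimal l x : 0 < l -> laplace V l x = kato U B l x.
Proof.
intros Hl.
assert (S_pm := kato_pm HX HPsi HU HBdom HBlin HBpos HAB).
assert (S_comm := kato_comm HX HPsi HU HBdom HBlin HBpos HAB).
assert (S_id := kato_identity HX HPsi HU HBdom HBlin HBpos HAB).
(* By [kato_generator_at] the range contains the domain of the generator of [U]. *)
assert (S_dense : dense (fun w : X => exists x, w = kato U B 1 x)).
{ apply dense_incl with (2 := generator_domain_dense HX HPsi HU).
  intros w [v Hv]. eexists. symmetry.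
  apply (kato_generator_at HX HPsi HU HBdom HBlin HBpos HAB 1 w v Rlt_0_1 Hv). }
set (W := euler_limit (kato U B)).
assert (HW : is_substochastic P W).
{ now apply (euler_limit_substochastic HX HPsi). }
assert (HWgen : forall w v, graph (kato U B) w v -> is_generator_at W w v).
{ intros w v. now apply (euler_limit_generator_at HX HPsi). }
assert (HWext : extends (generator W) (op_add (generator U) B)).
{ intros w [Hw _]. apply generator_dom in Hw.
  assert (H : is_generator_at W w (plus (generator U w) (B w))).
  { apply HWgen. intros m Hm.
    etransitivity;
      [|exact (kato_generator_at HX HPsi HU HBdom HBlin HBpos HAB m w _ Hm Hw)].
    f_equal. vec. }
  split; [eexists; exact H|]. now apply generator_op. }
(* The generator of [W] contains the pairs of [graph_S], and the resolvent of [W] is a left inverse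
   on them. *)
assert (HWK : forall y, laplace W l y = kato U B l y).
{ intros y. assert (H := HWgen _ _ (graph_S (kato U B) S_pm S_id l y Hl)).
  rewrite <- (laplace_generator_at HX HPsi HW l _ _ Hl H). f_equal. vec. }
apply (pm_eq_cone HX (P := P) (/ l) (/ l) (laplace V l) (kato U B l)).
- apply (laplace_pm HX HPsi minimal_substochastic l Hl).
- now apply S_pm.
- intros u Hu. apply (cone_le_antisym HX).
  + rewrite <- HWK. apply (laplace_mono HX HPsi V W minimal_substochastic HW l u Hl Hu).
    intros t Ht. now apply (proj2 (proj2 HV)).
  + now apply kato_le_laplace.
Qed.

End Minimality.

(** * Honesty *)

Section Honesty.
Context {X : CompleteNormedModule R_AbsRing} {P : X -> Prop} {Psi : X -> R}
  (HX : is_abstract_state_space P) (HPsi : is_norm_functional P Psi)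
  {U : R -> X -> X} (HU : is_substochastic P U) {B : operator X}
  (HBdom : forall w, dom B w <-> dom (generator U) w)
  (HBlin : is_linear_operator B)
  (HBpos : positive_operator P B)
  (HAB : forall w, dom (generator U) w -> P w ->
           (Psi (plus (generator U w) (B w)) <= 0)%R)
  {V : R -> X -> X} (HV : is_minimal_semigroup P (generator U) B V).

Local Notation zero := (@Hierarchy.zero X).
Local Notation plus := (@Hierarchy.plus X).
Local Notation opp := (@Hierarchy.opp X).
Local Notation minus := (@Hierarchy.minus X).
Local Notation scal := (@Hierarchy.scal R_AbsRing X).
Local Notation norm := (@Hierarchy.norm R_AbsRing X).
Local Notation sum_n := (@Hierarchy.sum_n X).

Let HVs : is_substochastic P V := minimal_substochastic HV.
Let K_pm := kick_pm HX HPsi HU HBdom HBlin HBpos HAB.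
Let Kn_pm := kick_iter_pm HX HPsi HU HBdom HBlin HBpos HAB.
Let K_mass := kick_mass HX HPsi HU HBdom HBpos HAB.

(** The mass which escapes through infinitely many applications of [B]; on
    [(lambda - G)^-1 u] it is the value of [a_0 - a_bar]. *)
Definition defect (l : R) (x : X) : R :=
  real (Lim_seq (fun n => Psi (Nat.iter n (kick U B l) x))).

Lemma kick_Psi_decr l u : 0 < l -> P u -> Psi (kick U B l u) <= Psi u.
Proof.
intros Hl Hu. rewrite !(Psi_norm HPsi); auto; [|now apply (pm_pos _ _ _ (K_pm l Hl))].
generalize (pm_bound _ _ _ (K_pm l Hl) u Hu). lra.
Qed.

Lemma defect_lim l x : 0 < l ->
  is_lim_seq (fun n => Psi (Nat.iter n (kick U B l) x)) (defect l x).
Proof.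
intros Hl. apply Lim_seq_correct'.
assert (H : forall u, P u -> ex_finite_lim_seq (fun n => Psi (Nat.iter n (kick U B l) u))).
{ intros u Hu. apply ex_finite_lim_seq_decr with 0; intros n.
  - apply kick_Psi_decr; auto. now apply (pm_pos _ _ _ (Kn_pm l n Hl)).
  - apply (Psi_nonneg HPsi). now apply (pm_pos _ _ _ (Kn_pm l n Hl)). }
destruct (cone_generating HX x) as (u & v & Hu & Hv & ->).
destruct (H u Hu) as [a Ha]. destruct (H v Hv) as [b Hb].
exists (a - b). eapply is_lim_seq_ext; [|exact (is_lim_seq_minus' _ _ _ _ Ha Hb)].
intros n. simpl. now rewrite (pm_minus _ _ (Kn_pm l n Hl)), (Psi_minus HPsi).
Qed.

Lemma defect_unique l x (b : R) : 0 < l ->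
  is_lim_seq (fun n => Psi (Nat.iter n (kick U B l) x)) b -> defect l x = b.
Proof. intros Hl. apply is_lim_seq_unique_real. now apply defect_lim. Qed.

Lemma defect_plus l x y : 0 < l -> defect l (plus x y) = defect l x + defect l y.
Proof.
intros Hl. apply defect_unique; auto.
eapply is_lim_seq_ext;
  [|exact (is_lim_seq_plus' _ _ _ _ (defect_lim l x Hl) (defect_lim l y Hl))].
intros n. simpl. now rewrite (pm_plus _ _ _ (Kn_pm l n Hl)), (Psi_plus HPsi).
Qed.

Lemma defect_scal l (r : R) x : 0 < l -> defect l (scal r x) = r * defect l x.
Proof.
intros Hl. apply defect_unique; auto.
eapply is_lim_seq_ext; [|exact (is_lim_seq_scal_l _ r _ (defect_lim l x Hl))].
intros n. simpl. now rewrite (pm_scal _ _ _ (Kn_pm l n Hl)), (Psi_scal HPsi).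
Qed.

Lemma defect_minus l x y : 0 < l -> defect l (minus x y) = defect l x - defect l y.
Proof.
intros Hl. replace (minus x y) with (plus x (scal (-1) y)) by vec.
rewrite defect_plus, defect_scal by auto. ring.
Qed.

Lemma defect_bounds l u : 0 < l -> P u -> 0 <= defect l u <= Psi u.
Proof.
intros Hl Hu.
assert (HK := fun n => pm_pos _ _ _ (Kn_pm l n Hl) u Hu).
split.
- apply is_lim_seq_le_real with (2 := is_lim_seq_const 0) (3 := defect_lim l u Hl).
  intros n. now apply (Psi_nonneg HPsi).
- apply (is_lim_seq_decr_compare _ _ (defect_lim l u Hl)) with (n := O).
  intros n. now apply kick_Psi_decr.
Qed.

(** On a decomposition into positive elements the defect is at most the sum of the two norms. The
    resulting continuity lets defects pass to limits of partial sums and of regularizations. *)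
Lemma defect_linear l : 0 < l -> is_linear (defect l : X -> R_NormedModule).
Proof.
intros Hl. destruct (cone_ball_bound HX HPsi) as (M & HM & HB). split.
- intros x y. now apply defect_plus.
- intros r x. now apply defect_scal.
- exists M. split; auto. intros x.
  destruct (HB x) as (u & v & Hu & Hv & E & H).
  change (Rabs (defect l x) <= M * norm x). apply Rle_trans with (2 := H).
  rewrite E at 1. rewrite defect_minus, <- !(Psi_norm HPsi) by auto.
  generalize (defect_bounds l u Hl Hu) (defect_bounds l v Hl Hv). intros h1 h2.
  apply Rabs_le. lra.
Qed.

Lemma defect_kick l x : 0 < l -> defect l (kick U B l x) = defect l x.
Proof.
intros Hl. apply defect_unique; auto.
apply is_lim_seq_ext with (fun n => Psi (Nat.iter (S n) (kick U B l) x)).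
{ intros n. now rewrite Nat.iter_succ_r. }
apply is_lim_seq_incr_1 with (u := fun n => Psi (Nat.iter n (kick U B l) x)).
now apply defect_lim.
Qed.

Lemma defect_kick_iter l n x : 0 < l -> defect l (Nat.iter n (kick U B l) x) = defect l x.
Proof. intros Hl. induction n as [|n IH]; auto. simpl. now rewrite defect_kick. Qed.

(** With f = l w - v the argument is f - K f, and [defect_kick] cancels the two: a_0 and a_bar agree
    on the domain of A. *)
Lemma defect_generator_at_zero l w v : 0 < l -> is_generator_at U w v ->
  defect l (minus (minus (scal l w) v) (B w)) = 0.
Proof.
intros Hl H.
replace (B w) with (kick U B l (minus (scal l w) v)).
2: { unfold kick. now rewrite (laplace_generator_at HX HPsi HU l w v Hl H). }
rewrite defect_minus, defect_kick by auto. ring.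
Qed.

(** With w_l = (l - A)^-1 u, the loss in one kick is a(w_l) + l [Psi](w_l). Both a and [Psi] are
    monotone on the cone within the domain, and w_m <= w_l, so replacing [l] by [m] multiplies the
    loss by at most [m / l]. *)
Lemma kick_loss_compare l m u : 0 < l <= m -> P u ->
  Psi u - Psi (kick U B m u) <= m / l * (Psi u - Psi (kick U B l u)).
Proof.
intros Hlm Hu. assert (Hl : 0 < l) by lra. assert (Hm : 0 < m) by lra.
assert (HRl := laplace_pm HX HPsi HU l Hl). assert (HRm := laplace_pm HX HPsi HU m Hm).
assert (H := mass_dissipation HPsi HAB _ _ (generator_at_minus HU _ _ _ _
  (generator_at_laplace HX HPsi HU l u Hl) (generator_at_laplace HX HPsi HU m u Hm))
  (laplace_decr HX HPsi HU m l u Hlm Hu)).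
destruct (op_minus HBlin (laplace U l u) (laplace U m u)) as [_ E];
  try now apply (dom_laplace HX HPsi HU HBdom).
rewrite E, !(Psi_minus HPsi), !(Psi_scal HPsi) in H.
fold (kick U B l u) in H. fold (kick U B m u) in H.
assert (H2 := K_mass l u Hl Hu).
rewrite <- !(Psi_norm HPsi) in H2; auto.
2: now apply (pm_pos _ _ _ HRl). 2: now apply (pm_pos _ _ _ (K_pm l Hl)).
assert (H3 := Psi_nonneg HPsi _ (laplace_decr HX HPsi HU m l u Hlm Hu)).
rewrite (Psi_minus HPsi) in H3.
apply Rle_trans with ((Psi u - Psi (kick U B l u) - l * Psi (laplace U l u))
  + m * Psi (laplace U l u)).
{ assert (m * Psi (laplace U m u) <= m * Psi (laplace U l u)).
  { apply Rmult_le_compat_l; lra. } lra. }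
replace (m * Psi (laplace U l u)) with (m / l * (l * Psi (laplace U l u))) by (field; lra).
assert (H4 : 1 <= m / l).
{ apply Rmult_le_reg_r with l; auto. unfold Rdiv. rewrite Rmult_assoc, Rinv_l; lra. }
assert (H5 : 0 <= Psi u - Psi (kick U B l u) - l * Psi (laplace U l u)) by lra.
nra.
Qed.

(** The losses of single kicks are summed. The iterates formed with [m] lie below those formed with
    [l], and the loss [Psi x - Psi (kick U B l x)] is monotone on the cone, so the single-kick
    comparison survives the summation. *)
Lemma defect_compare l m u : 0 < l <= m -> P u ->
  Psi u - defect m u <= m / l * (Psi u - defect l u).
Proof.
intros Hlm Hu. assert (Hl : 0 < l) by lra. assert (Hm : 0 < m) by lra.
assert (Hml : 0 <= m / l).
{ apply Rmult_le_pos; [lra|]. left; now apply Rinv_0_lt_compat. }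
apply is_lim_seq_le_real with (fun n => Psi u - Psi (Nat.iter n (kick U B m) u))
  (fun n => m / l * (Psi u - Psi (Nat.iter n (kick U B l) u))).
- intros n. induction n as [|n IH]; simpl; [lra|].
  assert (HKm := pm_pos _ _ _ (Kn_pm m n Hm) u Hu).
  assert (HKl := pm_pos _ _ _ (Kn_pm l n Hl) u Hu).
  set (x := Nat.iter n (kick U B m) u) in *. set (y := Nat.iter n (kick U B l) u) in *.
  assert (H1 := kick_loss_compare l m x Hlm HKm).
  assert (Hyx : P (minus y x)) by now apply (kick_iter_decr HX HPsi HU HBdom HBlin HBpos HAB).
  assert (H2 := kick_Psi_decr l (minus y x) Hl Hyx).
  rewrite (pm_minus _ _ (K_pm l Hl)), !(Psi_minus HPsi) in H2.
  assert (H3 : m / l * (Psi x - Psi (kick U B l x)) <= m / l * (Psi y - Psi (kick U B l y))).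
  { apply Rmult_le_compat_l; auto. lra. }
  lra.
- apply is_lim_seq_minus'; [apply is_lim_seq_const|now apply defect_lim].
- apply (is_lim_seq_scal_l _ (m / l) (Psi u - defect l u)).
  apply is_lim_seq_minus'; [apply is_lim_seq_const|now apply defect_lim].
Qed.

(* With [x_n = (B R_l)^n u] and [w_n] the partial sums of the series for the resolvent
   of [V], [m w_n - (A + B) w_n = (m - l) w_n + u - x_(n+1)] has no defect, while
   [defect m x_n] and [Psi x_n] have the same limit by [defect_compare]. *)
Lemma defect_shift l m u : 0 < l <= m -> P u ->
  defect l u = defect m (plus u (scal (m - l) (laplace V l u))).
Proof.
intros Hlm Hu. assert (Hl : 0 < l) by lra. assert (Hm : 0 < m) by lra.
rewrite (laplace_minimal HX HPsi HU HBdom HBlin HBpos HAB HV) by auto.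
set (x := fun n => Nat.iter n (kick U B l) u).
assert (Hx : forall n, P (x n)) by (intros n; now apply (pm_pos _ _ _ (Kn_pm l n Hl))).
apply is_lim_seq_unique_real with (fun n => defect m (x (S n))).
- apply is_lim_seq_incr_1 with (u := fun n => defect m (x n)).
  apply is_lim_seq_le_le with (fun n => Psi (x n) - m / l * (Psi (x n) - defect l u))
    (fun n => Psi (x n)).
  + intros n. generalize (defect_compare l m (x n) Hlm (Hx n)) (defect_bounds m (x n) Hm (Hx n)).
    unfold x. rewrite (defect_kick_iter l) by auto. fold (x n). lra.
  + replace (Finite (defect l u)) with
      (Finite (defect l u - m / l * (defect l u - defect l u))) by (f_equal; ring).
    apply is_lim_seq_minus'; [now apply defect_lim|].
    apply (is_lim_seq_scal_l _ (m / l) (defect l u - defect l u)).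
    apply is_lim_seq_minus'; [now apply defect_lim|apply is_lim_seq_const].
  + now apply defect_lim.
- eapply is_lim_seq_ext; [|apply (is_lim_seq_linear (defect m)
    (fun n => plus u (scal (m - l) (kato_sum U B l n u))))].
  + intros n. simpl.
    destruct (kato_sum_generator_at HX HPsi HU HBdom HBlin l n u Hl) as (v & Hv & Ev).
    generalize (defect_generator_at_zero m _ _ Hm Hv).
    replace (minus _ _) with (minus (plus u (scal (m - l) (kato_sum U B l n u))) (x (S n))).
    * rewrite defect_minus by auto. intros H. apply Rminus_diag_uniq. exact H.
    * transitivity (minus (scal m (kato_sum U B l n u)) (plus v (B (kato_sum U B l n u)))); [|vec].
      rewrite Ev. unfold x. vec.
  + now apply defect_linear.
  + apply (lim_plus (F := eventually)); [apply filterlim_const|].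
    apply (lim_scal (F := eventually)). now apply (kato_lim HX HPsi HU HBdom HBlin HBpos HAB).
Qed.

(** With f = l w - v one has w = (l - G)^-1 f, so m w - v = f + (m - l) (l - G)^-1 f. That is the
    shape of [defect_shift], extended from the cone by linearity. *)
Lemma defect_independent l m w v : 0 < l -> 0 < m -> is_generator_at V w v ->
  defect l (minus (scal l w) v) = defect m (minus (scal m w) v).
Proof.
revert l m.
assert (H : forall l m, 0 < l <= m -> is_generator_at V w v ->
  defect l (minus (scal l w) v) = defect m (minus (scal m w) v)).
{ intros l m Hlm H. assert (Hl : 0 < l) by lra. assert (Hm : 0 < m) by lra.
  assert (HQ := laplace_pm HX HPsi HVs l Hl).
  assert (E := laplace_generator_at HX HPsi HVs l w v Hl H).
  replace (minus (scal m w) v) with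
    (plus (minus (scal l w) v) (scal (m - l) (laplace V l (minus (scal l w) v)))).
  2: { rewrite E. vec. }
  clear E H. generalize (minus (scal l w) v). intros x.
  destruct (cone_generating HX x) as (a & b & Ha & Hb & ->).
  rewrite (pm_minus _ _ HQ).
  replace (plus (minus a b) (scal (m - l) (minus (laplace V l a) (laplace V l b)))) with
    (minus (plus a (scal (m - l) (laplace V l a))) (plus b (scal (m - l) (laplace V l b)))) by vec.
  rewrite !defect_minus by auto. apply (f_equal2 Rminus); now apply defect_shift. }
intros l m Hl Hm Hg. destruct (Rle_dec l m) as [Hlm|Hlm].
- apply H; auto.
- symmetry. apply H; auto. lra.
Qed.

(** The argument [l w - v] need not be positive. At m (m - G)^-1 w, independence of the parameter
    turns the value into [m * defect m w], which is nonnegative; these vectors and their generator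
    values tend to [w] and [v], and the defect is continuous. *)
Lemma defect_domain_nonneg l w v : 0 < l -> is_generator_at V w v -> P w ->
  0 <= defect l (minus (scal l w) v).
Proof.
intros Hl H Pw.
assert (Hn : forall n, 0 < INR (S n)) by (intros; apply lt_0_INR; lia).
apply is_lim_seq_le_real with (2 := is_lim_seq_const 0) (v := fun n =>
  defect l (minus (scal l (scal (INR (S n)) (laplace V (INR (S n)) w)))
    (scal (INR (S n)) (laplace V (INR (S n)) v)))).
- intros n. specialize (Hn n). set (m := INR (S n)) in *.
  assert (Hg := generator_at_scal HVs m _ _ (generator_at_laplace HX HPsi HVs m w Hn)).
  rewrite (laplace_generator_comm HX HPsi HVs m w v Hn H).
  rewrite (defect_independent l m _ _ Hl Hn Hg).
  replace (minus _ _) with (scal m w) by vec.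
  rewrite defect_scal by auto. apply Rmult_le_pos; [lra|]. now apply defect_bounds.
- apply (is_lim_seq_linear (defect l)); [now apply defect_linear|].
  apply (lim_minus (F := eventually)).
  + apply (lim_scal (F := eventually)). apply (laplace_large HX HPsi HVs).
  + apply (laplace_large HX HPsi HVs).
Qed.

(** * The functionals [a_bar] and [Xi] in terms of the defect *)

Lemma series_term_kato l n x : 0 < l ->
  series_term (generator U) B l x n = kato_term U B l n x.
Proof.
intros Hl. unfold series_term, kato_term.
rewrite (resolvent_generator HX HPsi HU) by auto. f_equal.
induction n as [|n IH]; simpl; auto.
rewrite IH, (resolvent_generator HX HPsi HU) by auto. reflexivity.
Qed.

Lemma mass_loss_series l x : 0 < l ->
  is_series (fun n => mass_loss Psi (op_add (generator U) B) (series_term (generator U) B l x n))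
    (Psi x - defect l x - l * Psi (laplace V l x)).
Proof.
intros Hl.
assert (E : forall n, mass_loss Psi (op_add (generator U) B) (series_term (generator U) B l x n) =
  Psi (Nat.iter n (kick U B l) x) - Psi (Nat.iter (S n) (kick U B l) x)
  - l * Psi (kato_term U B l n x)).
{ intros n. rewrite series_term_kato by auto. unfold mass_loss, op_add, kato_term. cbn [op].
  rewrite (generator_op _ _ (generator_at_laplace HX HPsi HU l _ Hl)).
  change (Nat.iter (S n) (kick U B l) x) with (B (laplace U l (Nat.iter n (kick U B l) x))).
  rewrite (Psi_plus HPsi), (Psi_minus HPsi), (Psi_scal HPsi). ring. }
assert (H : is_lim_seq (fun n => Psi x - Psi (Nat.iter (S n) (kick U B l) x)
  - l * Psi (kato_sum U B l n x)) (Psi x - defect l x - l * Psi (laplace V l x))).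
{ apply is_lim_seq_minus'; [apply is_lim_seq_minus'|].
  - apply is_lim_seq_const.
  - apply is_lim_seq_incr_1 with (u := fun n => Psi (Nat.iter n (kick U B l) x)).
    now apply defect_lim.
  - apply (is_lim_seq_scal_l _ l (Psi (laplace V l x))).
    rewrite (laplace_minimal HX HPsi HU HBdom HBlin HBpos HAB HV) by auto.
    apply (Psi_lim HPsi). now apply (kato_lim HX HPsi HU HBdom HBlin HBpos HAB). }
refine (filterlim_ext _ _ _ H). intros n. induction n as [|n IH].
- etransitivity; [|symmetry; exact (sum_O (G := R_AbelianMonoid) _)].
  rewrite E. unfold kato_sum. rewrite sum_n_0. simpl. ring.
- etransitivity; [|symmetry; exact (sum_Sn (G := R_AbelianMonoid) _ n)].
  etransitivity; [|exact (f_equal2 Rplus IH (eq_sym (E (S n))))].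
  unfold kato_sum. rewrite sum_n_S, (Psi_plus HPsi). ring.
Qed.

(** The description under [iota] asks for one sum valid for all representations of [w] as a
    resolvent value. [mass_loss_series] gives each representation its own sum, and
    [defect_independent] makes these sums equal. *)
Lemma a_bar_generator_at l w v : 0 < l -> is_generator_at V w v ->
  a_bar Psi (generator U) B (generator V) w = - Psi v - defect l (minus (scal l w) v).
Proof.
intros Hl H.
apply (@iota_unique R_AbsRing R_CompleteNormedModule).
- intros y Hy.
  assert (E := laplace_generator_at HX HPsi HVs l w v Hl H).
  assert (Hs := Hy l (minus (scal l w) v) Hl).
  rewrite (resolvent_generator HX HPsi HVs), E in Hs by auto.
  assert (Hs' := mass_loss_series l (minus (scal l w) v) Hl). rewrite E in Hs'.
  rewrite (@filterlim_locally_unique nat R_AbsRing R_NormedModule eventually _ _ _ _ (Hs eq_refl) Hs').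
  rewrite (Psi_minus HPsi), (Psi_scal HPsi). simpl. ring.
- intros m x Hm Hw. rewrite (resolvent_generator HX HPsi HVs) in Hw by auto.
  assert (Hg := generator_at_laplace HX HPsi HVs m x Hm). rewrite <- Hw in Hg.
  assert (Ev := generator_at_unique _ _ _ H Hg).
  assert (Ex : minus (scal m w) v = x) by (rewrite Ev; vec).
  rewrite (defect_independent l m w v Hl Hm H), Ex.
  replace (- Psi v) with (Psi x - m * Psi (laplace V m x)).
  + replace (Psi x - m * Psi (laplace V m x) - defect m x)
      with (Psi x - defect m x - m * Psi (laplace V m x)) by ring.
    now apply mass_loss_series.
  + rewrite <- Hw, <- Ex, (Psi_minus HPsi), (Psi_scal HPsi). ring.
Qed.

Lemma Xi_defect l x : 0 < l -> Xi Psi (generator U) B (generator V) l x = defect l x.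
Proof.
intros Hl. unfold Xi. rewrite (resolvent_generator HX HPsi HVs) by auto.
assert (Hg := generator_at_laplace HX HPsi HVs l x Hl).
rewrite (a_bar_generator_at l _ _ Hl Hg). unfold mass_loss.
rewrite (generator_op _ _ Hg).
replace (minus (scal l (laplace V l x)) (minus (scal l (laplace V l x)) x)) with x by vec.
ring.
Qed.

(** * Honesty as vanishing of the defect along the trajectory *)

Lemma generator_at_integral t u : 0 <= t ->
  is_generator_at V (orbit_integral V 0 t u) (minus (V t u) u).
Proof.
intros Ht. assert (H := generator_at_orbit_integral HX HPsi HVs 0 t u Ht).
rewrite Rmult_0_l, Ropp_0, exp_0 in H.
replace (minus (V t u) u) with
  (plus (scal 0 (orbit_integral V 0 t u)) (minus (scal 1 (V t u)) u)) by vec.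
exact H.
Qed.

(** Since G w_t = V(t) u - u and [Psi] is the norm on the cone, the lost mass
    [norm u - norm (V t u)] is exactly a_0(w_t); honesty at [t] therefore equates a_0 and a_bar at
    w_t. *)
Lemma honest_defect l u : 0 < l -> P u ->
  (honest Psi (generator U) B V u <-> forall t, 0 <= t ->
    defect l (minus (scal l (orbit_integral V 0 t u)) (minus (V t u) u)) = 0).
Proof.
intros Hl Hu.
assert (E : forall t, 0 <= t ->
  norm u - a_bar Psi (generator U) B (generator V) (RInt (fun s => V s u) 0 t) =
  norm (V t u) + defect l (minus (scal l (orbit_integral V 0 t u)) (minus (V t u) u))).
{ intros t Ht. rewrite (orbit_integral_RInt t u Ht).
  rewrite (a_bar_generator_at l _ _ Hl (generator_at_integral t u Ht)).
  rewrite (Psi_minus HPsi), !(Psi_norm HPsi); auto; [ring|].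
  now apply (pm_pos _ _ _ (semigroup_pm HVs t Ht)). }
split; intros H t Ht; specialize (H t Ht); rewrite E in *; auto; lra.
Qed.

(* [0 <= w_t <= exp (l t) (l - G)^-1 u] for [w_t] the integral of the trajectory, and
   [a_0 - a_bar] is monotone on the domain of [G]. *)
Lemma defect_honest l u : 0 < l -> P u -> defect l u = 0 ->
  honest Psi (generator U) B V u.
Proof.
intros Hl Hu H0. apply (honest_defect l); auto. intros t Ht.
assert (Hg := generator_at_integral t u Ht).
assert (HI := orbit_integral_pm HX HPsi HVs 0 t (Rle_refl 0) Ht).
assert (HQ := laplace_pm HX HPsi HVs l Hl).
assert (Hpos := defect_domain_nonneg l _ _ Hl Hg (pm_pos _ _ _ HI u Hu)).
apply Rle_antisym; auto.
assert (Hz := generator_at_minus HVs _ _ _ _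
  (generator_at_scal HVs (exp (l * t)) _ _ (generator_at_laplace HX HPsi HVs l u Hl)) Hg).
assert (Hz' : P (minus (scal (exp (l * t)) (laplace V l u)) (orbit_integral V 0 t u))).
{ apply (cone_le_trans HX) with (scal (exp (l * t)) (orbit_integral V l t u)).
  - apply (orbit_integral_compare HX HPsi V HVs); auto.
    intros s Hs. rewrite Rmult_0_l, Ropp_0, exp_0, <- exp_plus.
    rewrite <- exp_0. destruct (proj2 Hs) as [h| ->].
    + left. apply exp_increasing. nra.
    + right. f_equal. ring.
  - rewrite (orbit_integral_laplace HX HPsi HVs l t u Hl Ht).
    replace (minus _ _) with (scal (exp (l * t) * exp (- (l * t))) (laplace V l (V t u))) by vec.
    rewrite <- exp_plus. apply (cone_scal HX); [left; apply exp_pos|].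
    apply (pm_pos _ _ _ HQ). now apply (pm_pos _ _ _ (semigroup_pm HVs t Ht)). }
assert (H := defect_domain_nonneg l _ _ Hl Hz Hz').
(* This is l - G applied to exp(l t) (l - G)^-1 u - w_t; as [defect l u = 0], only minus the defect
   for w_t is left. *)
match type of H with 0 <= defect l ?x => replace x with
  (minus (scal (exp (l * t)) u)
    (minus (scal l (orbit_integral V 0 t u)) (minus (V t u) u))) in H by vec end.
rewrite defect_minus, defect_scal, H0 in H by auto. lra.
Qed.

(* [(l - G)^-1 u] is, up to [exp (- l n) (l - G)^-1 V(n) u], the integral of
   [exp (- l s) V(s) u] over [0, n], which is dominated by the integral of [V(s) u]. *)
Lemma honest_defect_zero l u : 0 < l -> P u ->
  honest Psi (generator U) B V u -> defect l u = 0.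
Proof.
intros Hl Hu H. apply Rle_antisym; [|now apply defect_bounds].
apply is_lim_seq_le_real with (2 := is_lim_seq_const (defect l u))
  (v := fun n => norm u * exp (- (l * INR n))).
- intros n. assert (Hn := pos_INR n). set (t := INR n) in *.
  assert (Hz := generator_at_minus HVs _ _ _ _ (generator_at_integral t u Hn)
    (generator_at_orbit_integral HX HPsi HVs l t u Hn)).
  assert (Hz' : P (minus (orbit_integral V 0 t u) (orbit_integral V l t u))).
  { replace (orbit_integral V 0 t u) with (scal 1 (orbit_integral V 0 t u)) by vec.
    apply (orbit_integral_compare HX HPsi V HVs); auto.
    intros s Hs. rewrite Rmult_0_l, Ropp_0, exp_0, Rmult_1_l.
    rewrite <- exp_0. destruct (proj1 Hs) as [h| <-].
    - left. apply exp_increasing. nra.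
    - right. f_equal. ring. }
  assert (H1 := defect_domain_nonneg l _ _ Hl Hz Hz').
  (* l - G sends the weighted integral to u - exp(- l t) V(t) u. Its defect is at most the one for
     w_t, which honesty makes zero, so [defect l u] is at most exp(- l t) times the defect of V(t)
     u. *)
  match type of H1 with 0 <= defect l ?x => replace x with
    (minus (minus (scal l (orbit_integral V 0 t u)) (minus (V t u) u))
      (minus u (scal (exp (- (l * t))) (V t u)))) in H1 by vec end.
  assert (HVt := pm_pos _ _ _ (semigroup_pm HVs t Hn) u Hu).
  rewrite !defect_minus, !defect_scal in H1 by auto.
  assert (H2 := proj1 (honest_defect l u Hl Hu) H t Hn). rewrite !defect_minus, defect_scal in H2 by auto.
  apply Rle_trans with (exp (- (l * t)) * defect l (V t u)); [lra|].
  rewrite (Rmult_comm (norm u)). apply Rmult_le_compat_l; [left; apply exp_pos|].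
  apply Rle_trans with (Psi (V t u)); [now apply defect_bounds|].
  rewrite (Psi_norm HPsi), <- (Rmult_1_l (norm u)) by auto.
  now apply (pm_bound _ _ _ (semigroup_pm HVs t Hn)).
- replace (Finite 0) with (Rbar_mult (norm u) 0) by (simpl; f_equal; ring).
  apply is_lim_seq_scal_l. now apply exp_INR_lim.
Qed.

End Honesty.

Theorem theorem3p11
  (X : CompleteNormedModule R_AbsRing) (P : X -> Prop) (Psi : X -> R)
  (HX : is_abstract_state_space P)
  (HPsi : is_norm_functional P Psi)
  (U : R -> X -> X) (HU : is_substochastic P U)
  (B : operator X)
  (HBdom : forall w, dom B w <-> dom (generator U) w)
  (HBlin : is_linear_operator B)
  (HBpos : positive_operator P B)
  (HAB : forall w, dom (generator U) w -> P w ->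
           (Psi (plus (generator U w) (B w)) <= 0)%R)
  (V : R -> X -> X) (HV : is_minimal_semigroup P (generator U) B V)
  (u : X) (Hu : P u) :
  (honest Psi (generator U) B V u <->
     (forall lambda : R, (0 < lambda)%R ->
        Xi Psi (generator U) B (generator V) lambda u = 0%R)) /\
  (honest Psi (generator U) B V u <->
     (exists lambda : R, (0 < lambda)%R /\
        Xi Psi (generator U) B (generator V) lambda u = 0%R)).
Proof.
assert (Hall : honest Psi (generator U) B V u -> forall lambda : R, 0 < lambda ->
  Xi Psi (generator U) B (generator V) lambda u = 0).
{ intros H l Hl. rewrite (Xi_defect HX HPsi HU HBdom HBlin HBpos HAB HV) by auto.
  now apply (honest_defect_zero HX HPsi HU HBdom HBlin HBpos HAB HV). }
assert (Hex : forall lambda : R, 0 < lambda ->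
  Xi Psi (generator U) B (generator V) lambda u = 0 -> honest Psi (generator U) B V u).
{ intros l Hl H. rewrite (Xi_defect HX HPsi HU HBdom HBlin HBpos HAB HV) in H by auto.
  now apply (defect_honest HX HPsi HU HBdom HBlin HBpos HAB HV l). }
split; split; auto.
- intros H. apply (Hex 1); auto using Rlt_0_1.
- intros H. exists 1. auto using Rlt_0_1.
- intros (l & Hl & H). now apply (Hex l).
Qed.
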